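(* There exists a planar 3-tree that does not have a non-crossing $\delta_2$-obstacle embedding.
   Context: Graphs are finite, simple and undirected. A 3-tree is a graph obtained from the complete graph $K_4$ by repeatedly choosing a clique on three vertices and adding a new vertex adjacent to exactly these three vertices. For $x\in\mathbb{R}^2$ and $i\in\{0,1,2,3\}$ let $Q^2_i(x)=x+\{r(\cos\theta,\sin\theta): r\ge 0,\ i\pi/2\le\theta\le (i+1)\pi/2\}$ be the $i$-th closed quadrant at $x$. A curve is a continuous map $f:[0,1]\to\mathbb{R}^2$; it is $\delta_2$-monotone if for some $i$ we have $f(b)\in Q^2_i(f(a))$ for all $0\le a\le b\le 1$ (these are the geodesics of the $L_1$ distance $\delta_2$). A non-crossing (or plane) $\delta_2$-obstacle embedding of $G$ is a pair $(\varphi,c)$, where $\varphi:V(G)\to\mathbb{R}^2$ is injective and $c$ assigns to each edge $uw$ a $\delta_2$-monotone curve with endpoints $\varphi(u),\varphi(w)$, such that the drawing is plane (edge curves are simple, contain no vertex points other than their endpoints, and two distinct edge curves meet only at a common endpoint), and such that whenever there is a path in $G$ with distinct end vertices $u,w$ whose edge curves concatenate to a $\delta_2$-monotone curve, then $uw\in E(G)$. *)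

(* Defs.v *)
From mathcomp Require Import all_boot all_order all_algebra.
From mathcomp Require Import all_classical all_reals all_analysis.

Set Implicit Arguments.
Unset Strict Implicit.
Unset Printing Implicit Defensive.

Import Order.TTheory GRing.Theory Num.Theory.
Import numFieldNormedType.Exports.

Local Open Scope ring_scope.

(** * Finite simple graphs and 3-trees *)

Record sgraph := SGraph {
  vertex :> finType;
  adj : rel vertex;
  adj_sym : symmetric adj;
  adj_irrefl : irreflexive adj
}.

Definition isomorphic (G H : sgraph) : Prop :=
  exists2 f : G -> H, bijective f & forall x y, adj (f x) (f y) = adj x y.

Definition clique (G : sgraph) (S : {set G}) : Prop :=
  {in S &, forall x y, x != y -> adj x y}.

Section Complete.
Variable n : nat.

Definition complete_adj : rel 'I_n := fun x y => x != y.

Lemma complete_sym : symmetric complete_adj.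
Proof. by move=> x y; rewrite /complete_adj eq_sym. Qed.

Lemma complete_irrefl : irreflexive complete_adj.
Proof. by move=> x; rewrite /complete_adj eqxx. Qed.

Definition complete : sgraph := SGraph complete_sym complete_irrefl.
End Complete.

Section AddVertex.
Variables (G : sgraph) (S : {set G}).

(* [None] is the new vertex; its neighbourhood is exactly [S]. *)
Definition add_adj : rel (option G) := fun x y =>
  match x, y with
  | Some a, Some b => adj a b
  | Some a, None => a \in S
  | None, Some b => b \in S
  | None, None => false
  end.

Lemma add_sym : symmetric add_adj.
Proof. by move=> [a|] [b|] //=; rewrite adj_sym. Qed.

Lemma add_irrefl : irreflexive add_adj.
Proof. by move=> [a|] //=; rewrite adj_irrefl. Qed.

Definition add_vertex : sgraph := SGraph add_sym add_irrefl.
End AddVertex.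

Inductive three_tree : sgraph -> Prop :=
| three_tree_K4 : three_tree (complete 4)
| three_tree_add (G : sgraph) (S : {set G}) :
    three_tree G -> #|S| = 3%N -> clique S -> three_tree (add_vertex S)
| three_tree_iso (G H : sgraph) :
    three_tree G -> isomorphic G H -> three_tree H.

(** * Curves in the plane *)

Section Curves.
Variable R : realType.

(* Curves are maps [R -> R * R] of which only the restriction to [[0, 1]]
   matters. *)
Definition is_curve (f : R -> R * R) : Prop :=
  {within `[0, 1], continuous f}%classic.

Definition quadrant (i : 'I_4) (x : R * R) : set (R * R) :=
  [set y | exists r theta : R,
    [/\ 0 <= r,
        i%:R * (pi / 2) <= theta <= i.+1%:R * (pi / 2)
      & y = (x.1 + r * cos theta, x.2 + r * sin theta)]]%classic.

Definition delta2_monotone (f : R -> R * R) : Prop :=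
  exists i : 'I_4, forall a b : R,
    0 <= a -> a <= b -> b <= 1 -> quadrant i (f a) (f b).

Definition curve_cat (f g : R -> R * R) : R -> R * R :=
  fun t => if t <= 1 / 2 then f (2 * t) else g (2 * t - 1).

(** * Drawings *)

Section Drawings.
Variables (G : sgraph) (phi : G -> R * R) (c : G -> G -> R -> R * R).

(* For an edge [uw], [c u w] is its curve traversed from [phi u] to [phi w];
   [c w u] is the same curve traversed backwards.  The values of [c] at
   non-adjacent pairs are irrelevant. *)
Record plane_drawing : Prop := PlaneDrawing {
  drawing_inj : injective phi;
  drawing_curve : forall u w, adj u w -> is_curve (c u w);
  drawing_source : forall u w, adj u w -> c u w 0 = phi u;
  drawing_target : forall u w, adj u w -> c u w 1 = phi w;
  drawing_rev : forall u w, adj u w ->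
    forall t : R, 0 <= t <= 1 -> c w u t = c u w (1 - t);
  drawing_simple : forall u w, adj u w ->
    forall s t : R, 0 <= s <= 1 -> 0 <= t <= 1 -> c u w s = c u w t -> s = t;
  drawing_vertex : forall u w, adj u w ->
    forall (v : G) (t : R), 0 <= t <= 1 -> c u w t = phi v -> v = u \/ v = w;
  drawing_cross : forall u w u' w', adj u w -> adj u' w' ->
    [set u; w]%SET != [set u'; w']%SET ->
    forall s t : R, 0 <= s <= 1 -> 0 <= t <= 1 -> c u w s = c u' w' t ->
    exists2 v : G, v \in ([set u; w] :&: [set u'; w'])%SET & c u w s = phi v
}.

(* Concatenated curve of the path [u, v, p_1, ..., p_k]. *)
Fixpoint path_curve (u v : G) (p : seq G) : R -> R * R :=
  if p is w :: p' then curve_cat (c u v) (path_curve v w p') else c u v.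

Record plane_delta2_obstacle_embedding : Prop := PlaneObstacleEmbedding {
  obstacle_plane : plane_drawing;
  obstacle_monotone : forall u w, adj u w -> delta2_monotone (c u w);
  obstacle_path : forall (u v : G) (p : seq G),
    path (@adj G) u (v :: p) -> uniq (u :: v :: p) ->
    delta2_monotone (path_curve u v p) -> adj u (last v p)
}.
End Drawings.

Definition planar (G : sgraph) : Prop :=
  exists (phi : G -> R * R) (c : G -> G -> R -> R * R), plane_drawing phi c.

Definition has_plane_delta2_obstacle_embedding (G : sgraph) : Prop :=
  exists (phi : G -> R * R) (c : G -> G -> R -> R * R),
    plane_delta2_obstacle_embedding phi c.
End Curves.

(* Main.v *)
(** For a vertex [d] off a triangle [abc], count modulo 2 the edges of [abc]
    passing above [d]. Disjoint monotone curves keep their vertical order over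
    the abscissae they share, and this alone makes the parity behave like the
    interior of a Jordan curve: adjacent vertices off [abc] have equal
    parities, and in each [K4] exactly one vertex is inside the triangle of the
    other three. Hence vertices stacked into an inner face are inside it and
    not adjacent to any vertex outside it.

    Give each edge a slope sign. Two edges of the same sign leaving a vertex in
    opposite directions form a monotone path, so their other ends are adjacent.
    If [d] is stacked into a triangle with monotone boundary path [a b c],
    comparability of [d] with [b] in the same direction, followed by one more
    stacking, gives a monotone path between non-adjacent vertices; so [d] is
    related to [b] by the other sign. Otherwise the triangle has a vertex [a]
    from which the other two are seen in the same quadrant, and each of the four
    possible positions of the vertex stacked into it is excluded by stacking at
    most twice more. So a triangle stacked five levels deep has no embedding. A
    straight-line drawing is obtained by stacking at the centroids of faces. *)

Require Import Defs.
From mathcomp Require Import all_boot all_order all_algebra.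
From mathcomp Require Import all_classical all_reals all_analysis.
From mathcomp Require Import ring lra zify.

Set Implicit Arguments.
Unset Strict Implicit.
Unset Printing Implicit Defensive.

Import Order.TTheory GRing.Theory Num.Theory.
Import numFieldNormedType.Exports.

Local Open Scope ring_scope.

(** * Parities of triangles *)

(* [z] lies strictly between [x] and [y]. *)
Definition between (x y z : int) : bool := (x < z < y) || (y < z < x).

(** Both sides say that the pairs [x], [y] and [z], [t] interlace on the line. *)
Lemma between_cross (x y z t : int) :
  x != z -> x != t -> y != z -> y != t ->
  between x y z (+) between x y t = between z t x (+) between z t y.
Proof. by rewrite /between; lia. Qed.

(** Four distinct points split into two pairs in three ways, exactly one of which interlaces. *)
Lemma between_pairs (x y z t : int) : uniq [:: x; y; z; t] ->
  (between x y z (+) between x y t) (+) (between x z y (+) between x z t)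
    (+) (between x t y (+) between x t z).
Proof.
move=> /and4P[]; rewrite !inE !negb_or => /and3P[xy xz xt] /andP[yz yt] zt _.
by rewrite /between; lia.
Qed.

(** A closed walk through [x], [y], [z] passes over [t] an even number of times. *)
Lemma between_triangle (x y z t : int) : x != t -> y != t -> z != t ->
  between x z t = between x y t (+) between y z t.
Proof. by rewrite /between; lia. Qed.

(** Neither the least nor the greatest of the four values lies strictly between two others, so at
    most two of the values do. *)
Lemma four_hulls (x y z t : int) :
  [|| x < t, y < t | z < t] && [|| t < x, t < y | t < z] ->
  [|| x < z, y < z | t < z] && [|| z < x, z < y | z < t] ->
  [|| y < x, z < x | t < x] && [|| x < y, x < z | x < t] -> False.
Proof.
move=> ht hz; have tb : (x < t < y) || (y < t < x) by lia.
have zb : (x < z < y) || (y < z < x) by lia.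
by clear ht hz; lia.
Qed.

(* What is kept of a drawing: the orders of the vertices by abscissa and by
   ordinate, and whether the edge [uv] passes above the vertex [w]. Field
   [above_cross] says, modulo 2, that two disjoint edges keep their vertical order
   over the interval of abscissae they share. *)
Record diagram (G : sgraph) (X Y : G -> int) (above : G -> G -> G -> bool) :
  Prop := Diagram {
  abscissa_inj : injective X;
  ordinate_inj : injective Y;
  above_sym u v w : above u v w = above v u w;
  above_between u v w : above u v w -> between (X u) (X v) (X w);
  above_low u v w : adj u v -> between (X u) (X v) (X w) ->
    Y w < Y u -> Y w < Y v -> above u v w;
  above_high u v w : adj u v -> Y u < Y w -> Y v < Y w -> ~~ above u v w;
  above_cross u v w z : adj u v -> adj w z ->
    u != w -> u != z -> v != w -> v != z ->
    above u v w (+) above u v z (+) (above w z u (+) above w z v)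
      = between (X u) (X v) (X w) (+) between (X u) (X v) (X z);
  rising_trans u v w : adj u v -> adj v w ->
    X u < X v -> X v < X w -> Y u < Y v -> Y v < Y w -> adj u w;
  falling_trans u v w : adj u v -> adj v w ->
    X u < X v -> X v < X w -> Y v < Y u -> Y w < Y v -> adj u w
}.

Lemma diagram_flipX (G : sgraph) (X Y : G -> int) above :
  diagram X Y above -> diagram (fun v => - X v) Y above.
Proof.
have betwN x y z : between (- x) (- y) (- z) = between x y z.
  by rewrite /between; lia.
case=> Xi Yi sS sB sL sH sC rT fT; split=> //.
- by move=> u v /oppr_inj/Xi.
- by move=> u v w; rewrite betwN; apply: sB.
- by move=> u v w; rewrite betwN; apply: sL.
- by move=> u v w z; rewrite !betwN; apply: sC.
- move=> u v w uv vw; rewrite !ltrN2 => vu wv uv' vw'.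
  by rewrite adj_sym; apply: (fT w v u) => //; rewrite adj_sym.
- move=> u v w uv vw; rewrite !ltrN2 => vu wv uv' vw'.
  by rewrite adj_sym; apply: (rT w v u) => //; rewrite adj_sym.
Qed.

(** Over its span, an edge passes above a vertex after the reflection exactly if it did not before;
    [between_cross] is what preserves [above_cross] under this complement. *)
Lemma diagram_flipY (G : sgraph) (X Y : G -> int) above :
  diagram X Y above ->
  diagram X (fun v => - Y v)
    (fun u v w => between (X u) (X v) (X w) && ~~ above u v w).
Proof.
case=> Xi Yi sS sB sL sH sC rT fT.
have Xn u v : u != v -> X u != X v by apply: contra_neq => /Xi.
have betwC x y z : between x y z = between y x z by rewrite /between; lia.
split=> //.
- by move=> u v /oppr_inj/Yi.
- by move=> u v w; rewrite betwC sS.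
- by move=> u v w /andP[].
- by move=> u v w uv b; rewrite !ltrN2 b => *; apply: sH.
- move=> u v w uv; rewrite !ltrN2 => h1 h2; rewrite negb_and negbK.
  by case b: between => //=; apply: sL.
- move=> u v w z uv wz uw uz vw vz.
  have := sC _ _ _ _ uv wz uw uz vw vz.
  have := between_cross (Xn _ _ uw) (Xn _ _ uz) (Xn _ _ vw) (Xn _ _ vz).
  move/implyP: (sB u v w); move/implyP: (sB u v z).
  move/implyP: (sB w z u); move/implyP: (sB w z v).
  by do 4!case: (above _ _ _); do 4!case: (between _ _ _).
- by move=> u v w uv vw; rewrite !ltrN2 => *; apply: (fT u v w).
- by move=> u v w uv vw; rewrite !ltrN2 => *; apply: (rT u v w).
Qed.

Definition K4 (G : sgraph) (a b c d : G) : bool :=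
  [&& adj a b, adj b c, adj a c & [&& adj a d, adj b d & adj c d]].

Lemma adj_neq (G : sgraph) (u v : G) : adj u v -> u != v.
Proof. by apply: contraTneq => ->; rewrite adj_irrefl. Qed.

Lemma K4_swap12 (G : sgraph) (a b c d : G) : K4 a b c d = K4 b a c d.
Proof. by rewrite /K4 (adj_sym a b); do 6!case: adj. Qed.

Lemma K4_swap23 (G : sgraph) (a b c d : G) : K4 a b c d = K4 a c b d.
Proof. by rewrite /K4 (adj_sym b c); do 6!case: adj. Qed.

Lemma K4_swap34 (G : sgraph) (a b c d : G) : K4 a b c d = K4 a b d c.
Proof. by rewrite /K4 (adj_sym c d); do 6!case: adj. Qed.

(* [x] is the vertex on the other side of the triangle [a b c], which the new
   vertex has to differ from. *)
Fixpoint filled (G : sgraph) (k : nat) (a b c x : G) : Prop :=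
  if k is k'.+1 then
    exists d, [/\ d != x, K4 a b c d, filled k' a b d c, filled k' b c d a
                & filled k' a c d b]
  else True.

Lemma filled_swap12 (G : sgraph) k (a b c x : G) :
  filled k a b c x -> filled k b a c x.
Proof.
elim: k a b c x => [|k IH] a b c x //= [d [dx K h1 h2 h3]].
by exists d; rewrite -K4_swap12; split=> //; apply: IH.
Qed.

Lemma filled_swap23 (G : sgraph) k (a b c x : G) :
  filled k a b c x -> filled k a c b x.
Proof.
elim: k a b c x => [|k IH] a b c x //= [d [dx K h1 h2 h3]].
by exists d; rewrite -K4_swap23; split=> //; apply: filled_swap12.
Qed.

Lemma filled_le (G : sgraph) k (a b c x : G) :
  filled k.+1 a b c x -> filled k a b c x.
Proof.
elim: k a b c x => [|k IH] a b c x //= [d [dx K h1 h2 h3]].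
by exists d; split=> //; apply: IH.
Qed.

Definition filled_around (G : sgraph) (k : nat) (a b c d : G) : Prop :=
  [/\ filled k a b d c, filled k b c d a & filled k a c d b].

Lemma filled_around_swap12 (G : sgraph) k (a b c d : G) :
  filled_around k a b c d -> filled_around k b a c d.
Proof. by case=> *; split=> //; apply: filled_swap12. Qed.

Lemma filled_around_swap23 (G : sgraph) k (a b c d : G) :
  filled_around k a b c d -> filled_around k a c b d.
Proof. by case=> *; split=> //; apply: filled_swap12. Qed.

Lemma filled_around_le (G : sgraph) k (a b c d : G) :
  filled_around k.+1 a b c d -> filled_around k a b c d.
Proof. by case=> *; split; apply: filled_le. Qed.

(* Meaningful only for [d] off the triangle [a b c]. *)
Definition inside (G : sgraph) (above : G -> G -> G -> bool) (a b c d : G) :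
  bool := above a b d (+) above b c d (+) above a c d.

(** * Parity of a triangle as its interior *)

Section Inside.
Variables (G : sgraph) (X Y : G -> int) (above : G -> G -> G -> bool).
Hypothesis D : diagram X Y above.
Implicit Types a b c d e : G.
Local Notation inside := (inside above).

Let X_neq u v : u != v -> X u != X v.
Proof. by apply: contra_neq => /(abscissa_inj D). Qed.

Let Y_neq u v : u != v -> Y u != Y v.
Proof. by apply: contra_neq => /(ordinate_inj D). Qed.

Lemma inside_swap12 a b c d : inside b a c d = inside a b c d.
Proof. by rewrite /inside (above_sym D b a) addbAC. Qed.

Lemma inside_swap23 a b c d : inside a c b d = inside a b c d.
Proof.
by rewrite /inside (above_sym D c b); do 3!case: (above _ _ _).
Qed.

Lemma inside_abscissa a b c d : inside a b c d ->
  [|| X a < X d, X b < X d | X c < X d] && [|| X d < X a, X d < X b | X d < X c].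
Proof.
rewrite /inside.
move: (above_between D (u := a) (v := b) (w := d)).
move: (above_between D (u := b) (v := c) (w := d)).
move: (above_between D (u := a) (v := c) (w := d)).
by rewrite /between; lia.
Qed.

(** If [d] were lowest, every side spanning it would pass above it, and an even number of sides span
    it; if [d] were highest, no side would pass above it. *)
Lemma inside_ordinate a b c d : K4 a b c d -> inside a b c d ->
  [|| Y a < Y d, Y b < Y d | Y c < Y d] && [|| Y d < Y a, Y d < Y b | Y d < Y c].
Proof.
case/and4P=> ab bc ac /and3P[ad bd cd]; rewrite /inside.
move: (Y_neq (adj_neq ad)) (Y_neq (adj_neq bd)) (Y_neq (adj_neq cd)).
move: (X_neq (adj_neq ad)) (X_neq (adj_neq bd)) (X_neq (adj_neq cd)).
move: (above_between D (u := a) (v := b) (w := d)).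
move: (above_between D (u := b) (v := c) (w := d)).
move: (above_between D (u := a) (v := c) (w := d)).
move: (above_low D (w := d) ab) (above_low D (w := d) bc)
  (above_low D (w := d) ac).
move: (above_high D (w := d) ab) (above_high D (w := d) bc)
  (above_high D (w := d) ac).
by rewrite /between; lia.
Qed.

(** Add [above_cross] for [de] and each side of [abc]: the terms of [above d e] at the corners occur
    twice, and the terms [between] cancel by [between_triangle]. *)
Lemma inside_adj a b c d e : adj a b -> adj b c -> adj a c -> adj d e ->
  a != d -> b != d -> c != d -> a != e -> b != e -> c != e ->
  inside a b c d = inside a b c e.
Proof.
move=> ab bc ac de ad bd cd ae be ce.
have xorE (x y z t : bool) : x (+) y (+) z = t -> x = y (+) z (+) t.
  by move=> <-; case: x; case: y; case: z.
have even v : a != v -> b != v -> c != v ->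
    between (X a) (X c) (X v) =
    between (X a) (X b) (X v) (+) between (X b) (X c) (X v).
  by move=> *; apply: between_triangle; apply: X_neq.
have Eab := xorE _ _ _ _ (above_cross D ab de ad ae bd be).
have Ebc := xorE _ _ _ _ (above_cross D bc de bd be cd ce).
have Eac := xorE _ _ _ _ (above_cross D ac de ad ae cd ce).
rewrite /inside Eab Ebc Eac !even //.
case: (above d e a); case: (above d e b); case: (above d e c);
  do 4!case: (between _ _ _); by do 3!case: (above _ _ _).
Qed.

(** Adding [above_cross] over the three pairs of opposite edges collects the twelve terms of the
    four parities on the left, while the right-hand sides add up to one by [between_pairs]. *)
Lemma inside_odd a b c d : K4 a b c d ->
  inside b c d a (+) inside a c d b (+) inside a b d c (+) inside a b c d.
Proof.
case/and4P=> ab bc ac /and3P[ad bd cd].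
have nab := adj_neq ab; have nbc := adj_neq bc; have nac := adj_neq ac.
have nad := adj_neq ad; have nbd := adj_neq bd; have ncd := adj_neq cd.
have ncb : c != b by rewrite eq_sym.
have ndb : d != b by rewrite eq_sym.
have ndc : d != c by rewrite eq_sym.
have := between_pairs (x := X a) (y := X b) (z := X c) (t := X d).
rewrite /= !inE !negb_or !X_neq // => /(_ isT).
rewrite -(above_cross D ab cd) // -(above_cross D ac bd) //.
rewrite -(above_cross D ad bc) // /inside.
by do 12!case: (above _ _ _).
Qed.

(** By [inside_odd] a second inner vertex brings a third one, which the abscissae forbid. *)
Lemma inside_uniq a b c d : K4 a b c d -> inside a b c d -> ~~ inside a b d c.
Proof.
move=> K I; apply/negP=> I'; have := inside_odd K; rewrite I I' -addbA addbF.
have hd := inside_abscissa I; have hc := inside_abscissa I'.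
case Ia : (inside b c d a) => /=.
  by case: (four_hulls hd hc (inside_abscissa Ia)).
case Ib : (inside a c d b) => // _; apply: (four_hulls (x := X b) (y := X a)).
- by rewrite orbCA [X in _ && X]orbCA; apply: hd.
- by rewrite orbCA [X in _ && X]orbCA; apply: hc.
- exact: inside_abscissa Ib.
Qed.

(** Being adjacent to [d], [a] and [b], the vertex [e] has their parities in the triangles [abc],
    [bcd] and [acd]. The last two agree by [inside_odd], and the three add up to the parity of [e]
    in [abd]. That of [c] is different, so [e] and [c] are not adjacent. *)
Lemma inside_stack a b c d e : K4 a b c d -> inside a b c d ->
  K4 a b d e -> e != c -> inside a b d e /\ ~~ adj e c.
Proof.
move=> K I Ke ec; have odd := inside_odd K; have nI := inside_uniq K I.
have /and4P[ab bc ac /and3P[ad bd cd]] := K.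
have /and4P[_ _ _ /and3P[ae be de]] := Ke.
have nab := adj_neq ab; have nbc := adj_neq bc; have nac := adj_neq ac.
have nad := adj_neq ad; have nbd := adj_neq bd; have ncd := adj_neq cd.
have nae := adj_neq ae; have nbe := adj_neq be; have nde := adj_neq de.
have nce : c != e by rewrite eq_sym.
have nba : b != a by rewrite eq_sym.
have nca : c != a by rewrite eq_sym.
have nda : d != a by rewrite eq_sym.
have ncb : c != b by rewrite eq_sym.
have ndb : d != b by rewrite eq_sym.
have hd : inside a b c d = inside a b c e by apply: inside_adj.
have ha : inside b c d a = inside b c d e by apply: inside_adj.
have hb : inside a c d b = inside a c d e by apply: inside_adj.
have ndc : d != c by rewrite eq_sym.
have Ie : inside a b d e.
  have -> : inside a b d e = inside a b c e (+) inside b c d e (+) inside a c d e.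
    by rewrite /inside; do 6!case: (above _ _ _).
  rewrite -hd -ha -hb; move: odd nI I.
  by do 4!case: (inside _ _ _ _).
split=> //; apply/negP => aec.
have := inside_adj ab bd ad aec nae nbe nde nac nbc ndc.
by rewrite Ie (negPf nI).
Qed.

End Inside.

(** * Monotone paths created by stacking *)

Section Stacking.
Variables (G : sgraph) (X Y : G -> int) (above : G -> G -> G -> bool).
Hypothesis D : diagram X Y above.
Implicit Types a b c d e : G.
Local Notation inside := (inside above).

Let adjC a b : adj a b -> adj b a.
Proof. by rewrite adj_sym. Qed.

Lemma filled_inside k a b c d : K4 a b c d -> inside a b c d ->
  filled k.+1 a b d c ->
  exists e, [/\ K4 a b d e, inside a b d e, ~~ adj e c
        & filled_around k a b d e].
Proof.
move=> K I [e [ec Ke h1 h2 h3]].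
by have [] := inside_stack D K I Ke ec; exists e.
Qed.

Lemma filled_around_inside k a b c d : K4 a b c d -> inside a b c d ->
  filled_around k.+1 a b c d ->
  [/\ exists e, [/\ K4 a b d e, inside a b d e, ~~ adj e c
        & filled_around k a b d e],
      exists e, [/\ K4 b c d e, inside b c d e, ~~ adj e a
        & filled_around k b c d e]
    & exists e, [/\ K4 a c d e, inside a c d e, ~~ adj e b
        & filled_around k a c d e]].
Proof.
move=> K I [h1 h2 h3]; split; apply: filled_inside => //.
- by rewrite K4_swap23 K4_swap12.
- by rewrite (inside_swap23 D) (inside_swap12 D).
- by rewrite K4_swap23.
- by rewrite (inside_swap23 D).
Qed.

(* If, say, [d] lies to the lower left of [b], a vertex [e] stacked into [a b d]
   lies to the lower left of [b] as well, whence [e] and [c] are adjacent. *)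
Lemma rising_middle a b c d : X a < X b -> X b < X c -> Y a < Y b -> Y b < Y c ->
  K4 a b c d -> inside a b c d -> filled_around 1 a b c d ->
  (X d < X b) = (Y b < Y d).
Proof.
move=> Xab Xbc Yab Ybc K I F.
have /and4P[ab bc ac /and3P[ad bd cd]] := K.
have [[e [Ke Ie ec _]] [f [Kf If fa _]] _] := filled_around_inside K I F.
have neqX : X d != X b.
  by rewrite eq_sym (contra_neq (@abscissa_inj _ _ _ _ D _ _)) ?adj_neq.
have neqY : Y d != Y b.
  by rewrite eq_sym (contra_neq (@ordinate_inj _ _ _ _ D _ _)) ?adj_neq.
have Xd := inside_abscissa D I; have Yd := inside_ordinate D K I.
have Xe := inside_abscissa D Ie; have Ye := inside_ordinate D Ke Ie.
have Xf := inside_abscissa D If; have Yf := inside_ordinate D Kf If.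
case: (ltgtP (X d) (X b)) neqX => // Xdb _;
  case: (ltgtP (Y d) (Y b)) neqY => // Ydb _; exfalso.
- case/negP: ec; have /and4P[_ _ _ /and3P[_ be _]] := Ke.
  by apply: (rising_trans D (adjC be) bc) => //;
    [move: Xe Xab Xdb | move: Ye Yab Ydb]; clear; lia.
- case/negP: fa; have /and4P[_ _ _ /and3P[bf _ _]] := Kf.
  apply: adjC; by apply: (rising_trans D ab bf) => //;
    [move: Xf Xbc Xdb | move: Yf Ybc Ydb]; clear; lia.
Qed.

(** The span of [de] contains neither [a] nor [b], so [above_cross] reduces to its two terms for
    [ab]. *)
Lemma above_nested a b d e : adj a b -> adj d e ->
  between (X a) (X b) (X d) -> between (X a) (X b) (X e) ->
  above a b d = above a b e.
Proof.
move=> ab de ad ae.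
have neq u v : X u != X v -> u != v by apply: contra_neq => ->.
have := above_cross D ab de; rewrite ad ae.
have [/neq -> /neq -> /neq -> /neq ->] : [/\ X a != X d, X a != X e, X b != X d
  & X b != X e].
  by move: ad ae; clear; rewrite /between => ad ae; split; lia.
have above0 u : ~~ between (X d) (X e) (X u) -> above d e u = false.
  by move=> h; apply/negbTE; apply: contra h; apply: (above_between D).
rewrite !above0; first by case: above; case: above => // /(_ isT isT isT isT).
all: by move: ad ae; rewrite /between; clear; lia.
Qed.

Lemma above_left u v w : X w <= X u -> X w <= X v -> above u v w = false.
Proof.
move=> uw vw; apply/negbTE; apply: (contra (@above_between _ _ _ _ D u v w)).
by move: uw vw; rewrite /between; clear; lia.
Qed.

Lemma above_right u v w : X u <= X w -> X v <= X w -> above u v w = false.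
Proof.
move=> uw vw; apply/negbTE; apply: (contra (@above_between _ _ _ _ D u v w)).
by move: uw vw; rewrite /between; clear; lia.
Qed.

End Stacking.

(** The reflection complements the terms of the sides spanning [d], an even number of them. *)
Lemma inside_flipY (G : sgraph) (X Y : G -> int) above (a b c d : G) :
  diagram X Y above -> K4 a b c d ->
  inside (fun u v w => between (X u) (X v) (X w) && ~~ above u v w) a b c d
    = inside above a b c d.
Proof.
move=> D /and4P[_ _ _ /and3P[ad bd cd]].
have Xn u v : adj u v -> X u != X v.
  by move=> /adj_neq; apply: contra_neq => /(abscissa_inj D).
rewrite /inside (between_triangle (Xn _ _ ad) (Xn _ _ bd) (Xn _ _ cd)).
have := between_triangle (Xn _ _ ad) (Xn _ _ bd) (Xn _ _ cd).
move/implyP: (@above_between _ _ _ _ D a b d).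
move/implyP: (@above_between _ _ _ _ D b c d).
move/implyP: (@above_between _ _ _ _ D a c d).
by do 3!case: (above _ _ _); do 3!case: (between _ _ _).
Qed.

(** * Excluding filled triangles by the slopes of their edges *)

Section Bicolored.
Variables (G : sgraph) (X Y : G -> int) (above : G -> G -> G -> bool).
Hypothesis D : diagram X Y above.
Implicit Types a b c d e : G.
Local Notation inside := (inside above).

Let adjC a b : adj a b -> adj b a.
Proof. by rewrite adj_sym. Qed.

Let neqX a b : adj a b -> X a != X b.
Proof. by move=> /adj_neq; apply: contra_neq => /(abscissa_inj D). Qed.

Let neqY a b : adj a b -> Y a != Y b.
Proof. by move=> /adj_neq; apply: contra_neq => /(ordinate_inj D). Qed.

Lemma falling_middle a b c d : X a < X b -> X b < X c -> Y b < Y a -> Y c < Y b ->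
  K4 a b c d -> inside a b c d -> filled_around 1 a b c d ->
  (X d < X b) = (Y d < Y b).
Proof.
move=> Xab Xbc Yba Ycb K I F.
have := rising_middle (diagram_flipY D) Xab Xbc _ _ K _ F.
by rewrite !ltrN2 (inside_flipY D K) => ->.
Qed.

(* [a] is the lower left corner of the bounding box, [b] is the top vertex and [c]
   the rightmost one. The four lemmas below are named after the slopes of the edges
   [db] and [dc]. *)
Section Corner.
Variables a b c d : G.
Hypotheses (Xab : X a < X b) (Xbc : X b < X c).
Hypotheses (Yac : Y a < Y c) (Ycb : Y c < Y b).
Hypotheses (K : K4 a b c d) (I : inside a b c d).

Let ad : adj a d. Proof. by case/and4P: K => _ _ _ /and3P[]. Qed.
Let bd : adj b d. Proof. by case/and4P: K => _ _ _ /and3P[]. Qed.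
Let cd : adj c d. Proof. by case/and4P: K => _ _ _ /and3P[]. Qed.

Let Xad : X a < X d.
Proof. by move: (inside_abscissa D I) Xab Xbc; clear; lia. Qed.
Let Xdc : X d < X c.
Proof. by move: (inside_abscissa D I) Xab Xbc; clear; lia. Qed.
Let Yad : Y a < Y d.
Proof. by move: (inside_ordinate D K I) Yac Ycb; clear; lia. Qed.
Let Ydb : Y d < Y b.
Proof. by move: (inside_ordinate D K I) Yac Ycb; clear; lia. Qed.

(** Any [g] stacked into [bcd] lies to the upper right of [d], so [a d g] is a rising path. *)
Lemma corner_rising_rising : X d < X b -> Y d < Y c -> ~ filled_around 1 a b c d.
Proof.
move=> Xdb Ydc F; have [_ [g [Kg Ig ga _]] _] := filled_around_inside D K I F.
have /and4P[_ _ _ /and3P[_ _ dg]] := Kg.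
case/negP: ga; apply: adjC; apply: (rising_trans D ad dg) => //.
  by move: (inside_abscissa D Ig) Xdb Xdc; clear; lia.
by move: (inside_ordinate D Kg Ig) Ydc Ydb; clear; lia.
Qed.

(** Let [e] be stacked into [abd], where [a d b] rises. To the upper left of [d] it gives the
    falling path [e d c]. To the lower right, both [ab] and [bd] pass above it while [ad] does not,
    so it is not inside [abd]. *)
Lemma corner_rising_falling : X d < X b -> Y c < Y d -> ~ filled_around 2 a b c d.
Proof.
move=> Xdb Ycd F; have [[e [Ke Ie ec Fe]] _ _] := filled_around_inside D K I F.
have Ke' : K4 a d b e by rewrite K4_swap23.
have Ie' : inside a d b e by rewrite (inside_swap23 D).
have Fe' := filled_around_swap23 Fe.
have := rising_middle D Xad Xdb Yad Ydb Ke' Ie' Fe'.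
have /and4P[ab _ _ /and3P[ae be de]] := Ke.
case: (ltgtP (X e) (X d)) (neqX de) => // [Xed|Xde] _.
  move=> /esym Yde; case/negP: ec.
  exact: (falling_trans D (adjC de) (adjC cd)).
case: (ltgtP (Y d) (Y e)) (neqY de) => // Yed _ _.
have [Xae Xeb] : X a < X e /\ X e < X b.
  by move: (inside_abscissa D Ie) Xad Xdb Xde; clear; lia.
have abd : above a b d.
  move: I; rewrite /inside (@above_left _ _ _ _ D b c d) ?ltW //.
  by rewrite (negPf (@above_high _ _ _ _ D a c d _ _ _)) ?addbF //; case/and4P: K.
have := Ie; rewrite /inside -(above_nested D ab de) ?abd; last 2 first.
- by rewrite /between Xad Xdb.
- by rewrite /between Xae Xeb.
rewrite (@above_right _ _ _ _ D a d e) ?(ltW Xae) ?(ltW Xde) //.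
rewrite (@above_low _ _ _ _ D b d e) // ?(lt_trans Yed) //.
by rewrite /between Xde Xeb orbT.
Qed.

(** Let [e] be stacked into [acd], where [a d c] rises. To the lower right of [d] it gives the
    falling path [b d e]. To the upper left, no side of [acd] passes above it. *)
Lemma corner_falling_rising : X b < X d -> Y d < Y c -> ~ filled_around 2 a b c d.
Proof.
move=> Xbd Ydc F; have [_ _ [e [Ke Ie eb Fe]]] := filled_around_inside D K I F.
have Ke' : K4 a d c e by rewrite K4_swap23.
have Ie' : inside a d c e by rewrite (inside_swap23 D).
have Fe' := filled_around_swap23 Fe.
have := rising_middle D Xad Xdc Yad Ydc Ke' Ie' Fe'.
have /and4P[ac _ _ /and3P[ae ce de]] := Ke.
case: (ltgtP (X e) (X d)) (neqX de) => // [Xed|Xde] _; last first.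
  case: (ltgtP (Y d) (Y e)) (neqY de) => // Yed _ _; case/negP: eb.
  by apply: adjC; apply: (falling_trans D bd de).
move=> /esym Yde.
have Xae : X a < X e.
  by move: (inside_abscissa D Ie) Xad Xdc Xed; clear; lia.
have acd : above a c d = false.
  move: I; rewrite /inside (@above_right _ _ _ _ D a b d) ?ltW //.
  rewrite (@above_low _ _ _ _ D b c d) //; first by case: above.
  - by case/and4P: K.
  - by rewrite /between Xbd Xdc.
have := Ie; rewrite /inside -(above_nested D ac de) ?acd; last 2 first.
- by rewrite /between Xad Xdc.
- by rewrite /between Xae (lt_trans Xed Xdc).
rewrite (@above_left _ _ _ _ D c d e) ?(ltW Xed) ?(ltW (lt_trans Xed Xdc)) //.
by rewrite (negPf (@above_high _ _ _ _ D a d e _ _ _)) // (lt_trans Yad).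
Qed.

(** Let [f] and [g] be stacked into [acd] and [bcd]. To avoid the falling path [b d f], [f] is to
    the lower left of [d]. If [g] is to the upper right, the rising path [f d g] joins a vertex
    outside [bcd] to one inside. If [g] is to the lower left, exactly [bc] and [bd] pass above it,
    so it is not inside [bcd]. *)
Lemma corner_falling_falling : X b < X d -> Y c < Y d -> ~ filled_around 2 a b c d.
Proof.
move=> Xbd Ycd F.
have [_ [g [Kg Ig ga Fg]] [f [Kf If fb Ff]]] := filled_around_inside D K I F.
have Kg' : K4 b d c g by rewrite K4_swap23.
have Ig' : inside b d c g by rewrite (inside_swap23 D).
have := falling_middle Xbd Xdc Ydb Ycd Kg' Ig' (filled_around_swap23 Fg).
have /and4P[bc _ _ /and3P[bg cg dg]] := Kg.
have /and4P[ac _ _ /and3P[af cf df]] := Kf.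
have Yfd : Y f < Y d.
  by move: (inside_ordinate D Kf If) Yad Ycd; clear; lia.
have Xfd : X f < X d.
  case: (ltgtP (X f) (X d)) (neqX df) => // Xdf _; case/negP: fb.
  by apply: adjC; apply: (falling_trans D bd df).
case: (ltgtP (X g) (X d)) (neqX dg) => // [Xgd|Xdg] _; last first.
  case: (ltgtP (Y g) (Y d)) (neqY dg) => // Ydg _ _.
  have fg : adj f g by apply: (rising_trans D (adjC df) dg).
  have bf : b != f by apply: contraTneq Yfd => <-; rewrite -leNgt ltW.
  have /and4P[ab _ _ _] := K.
  have nbc := adj_neq bc; have nbd := adj_neq bd; have ncd := adj_neq cd.
  have nba := adj_neq (adjC ab); have nca := adj_neq (adjC ac).
  have nda := adj_neq (adjC ad).
  have := inside_adj D bc cd bd fg bf (adj_neq cf) (adj_neq df) (adj_neq bg)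
    (adj_neq cg) (adj_neq dg).
  rewrite -(inside_adj D bc cd bd af) ?(adj_neq cf) ?(adj_neq df) // Ig.
  apply/negP; apply: (inside_uniq D).
    by rewrite K4_swap23 K4_swap12.
  by rewrite (inside_swap23 D) (inside_swap12 D).
move=> /esym Ygd.
have Xbg : X b < X g.
  by move: (inside_abscissa D Ig) Xbd Xdc Xgd; clear; lia.
have bcd : above b c d.
  move: I; rewrite /inside (@above_right _ _ _ _ D a b d) ?ltW //.
  by rewrite (negPf (@above_high _ _ _ _ D a c d _ _ _)) ?addbF.
have := Ig; rewrite /inside -(above_nested D bc dg) ?bcd; last 2 first.
- by rewrite /between Xbd Xdc.
- by rewrite /between Xbg (lt_trans Xgd Xdc).
rewrite (@above_left _ _ _ _ D c d g) ?(ltW Xgd) ?(ltW (lt_trans Xgd Xdc)) //.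
rewrite (@above_low _ _ _ _ D b d g) // ?(lt_trans Ygd) //.
by rewrite /between Xbg Xgd.
Qed.

Lemma corner_not_filled : ~ filled_around 2 a b c d.
Proof.
move=> F; case: (ltgtP (X d) (X b)) (neqX bd) => // Xdb _;
  case: (ltgtP (Y d) (Y c)) (neqY cd) => // Ydc _.
- exact: (corner_rising_rising Xdb Ydc (filled_around_le F)).
- exact: corner_rising_falling F.
- exact: corner_falling_rising F.
- exact: corner_falling_falling F.
Qed.

End Corner.
End Bicolored.

(** By [rising_middle], [d] is to the lower right or the upper left of [b]. Either way [abd] is a
    triangle with lower left corner [a], with [b] as its top or its rightmost vertex. *)
Lemma rising_not_filled (G : sgraph) (X Y : G -> int) above (a b c d : G) :
  diagram X Y above ->
  X a < X b -> X b < X c -> Y a < Y b -> Y b < Y c ->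
  K4 a b c d -> inside above a b c d -> ~ filled_around 3 a b c d.
Proof.
move=> D Xab Xbc Yab Ybc K I F.
have := rising_middle D Xab Xbc Yab Ybc K I (filled_around_le (filled_around_le F)).
have [[e [Ke Ie _ Fe]] _ _] := filled_around_inside D K I F.
have Xd := inside_abscissa D I; have Yd := inside_ordinate D K I.
have /and4P[_ _ _ /and3P[_ bd _]] := K.
have neqX : X b != X d.
  by move: (adj_neq bd); apply: contra_neq => /(abscissa_inj D).
have neqY : Y b != Y d.
  by move: (adj_neq bd); apply: contra_neq => /(ordinate_inj D).
case: (ltgtP (X b) (X d)) neqX => // [Xbd|Xdb] _.
  move=> /esym/negbT; rewrite -leNgt => Ydb.
  apply: (corner_not_filled D _ _ _ _ Ke Ie Fe) => //.
  - by move: Yd Yab Ybc Ydb; clear; lia.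
  - by rewrite lt_neqAle Ydb eq_sym neqY.
move=> /esym Ybd.
apply: (corner_not_filled D _ _ _ _ _ _ (filled_around_swap23 Fe)) => //.
- by move: Xd Xab Xbc Xdb; clear; lia.
- by rewrite K4_swap23.
- by rewrite (inside_swap23 D).
Qed.

(** Once the abscissae are sorted, either the ordinates are monotone or [b] has an extreme ordinate;
    reflections turn these cases into [rising_not_filled] and [corner_not_filled]. *)
Lemma inside_not_filled (G : sgraph) (X Y : G -> int) above (a b c d : G) :
  diagram X Y above -> K4 a b c d -> inside above a b c d ->
  ~ filled_around 3 a b c d.
Proof.
move=> D; have Xn u v : adj u v -> X u != X v.
  by move=> /adj_neq; apply: contra_neq => /(abscissa_inj D).
wlog Xab : a b c / X a < X b => [IH K I F|].
  have /and4P[/Xn] := K; case: (ltgtP (X a) (X b)) => // Xab _ _ _ _.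
    exact: (IH a b c).
  have K' : K4 b a c d by rewrite K4_swap12.
  have I' : inside above b a c d by rewrite (inside_swap12 D).
  exact: (IH b a c Xab K' I' (filled_around_swap12 F)).
wlog Xbc : a b c Xab / X b < X c => [IH K I F|].
  have /and4P[_ /Xn bc /Xn ac _] := K.
  case: (ltgtP (X b) (X c)) bc => // [Xbc|Xcb] _; first exact: (IH a b c).
  have K' : K4 a c b d by rewrite K4_swap23.
  have I' : inside above a c b d by rewrite (inside_swap23 D).
  have F' := filled_around_swap23 F.
  case: (ltgtP (X a) (X c)) ac => // [Xac|Xca] _; first exact: (IH a c b).
  have K'' : K4 c a b d by rewrite K4_swap12.
  have I'' : inside above c a b d by rewrite (inside_swap12 D).
  exact: (IH c a b Xca Xab K'' I'' (filled_around_swap12 F')).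
move=> K I F.
have Yn u v : adj u v -> Y u != Y v.
  by move=> /adj_neq; apply: contra_neq => /(ordinate_inj D).
(* Negating the abscissae reverses their order, so the triangle is then read as [c b a]. *)
have DX := diagram_flipX D; have DY := diagram_flipY D.
have DXY := diagram_flipX DY.
have Kr : K4 c b a d by rewrite K4_swap23 K4_swap12 K4_swap23.
have Ir : inside above c b a d.
  by rewrite (inside_swap23 D) (inside_swap12 D) (inside_swap23 D).
have Fr : filled_around 3 c b a d.
  by apply/filled_around_swap23/filled_around_swap12/filled_around_swap23.
have IY := I; rewrite -(inside_flipY D K) in IY.
have IrY := Ir; rewrite -(inside_flipY D Kr) in IrY.
have /and4P[/Yn ab /Yn bc /Yn ac _] := K.
case: (ltgtP (Y a) (Y b)) ab => // Yab _;
  case: (ltgtP (Y b) (Y c)) bc => // Ybc _.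
- exact: (rising_not_filled D Xab Xbc Yab Ybc K I F).
- case: (ltgtP (Y a) (Y c)) ac => // Yac _.
    exact: (corner_not_filled D Xab Xbc Yac Ybc K I (filled_around_le F)).
  apply: (corner_not_filled DX _ _ _ _ Kr Ir (filled_around_le Fr));
    by rewrite ?ltrN2.
- case: (ltgtP (Y a) (Y c)) ac => // Yac _.
    apply: (corner_not_filled DXY _ _ _ _ Kr IrY (filled_around_le Fr));
    by rewrite ?ltrN2.
  apply: (corner_not_filled DY _ _ _ _ K IY (filled_around_le F));
    by rewrite ?ltrN2.
- apply: (rising_not_filled DY _ _ _ _ K IY F); by rewrite ?ltrN2.
Qed.

(* In the drawing at hand any of the four faces of [K4] may be the outer one;
   if it is not [a b c], the inner vertex is one of [a], [b], [c], and a face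
   at this vertex other than [a b c] is bounded and filled. *)
Lemma diagram_not_filled (G : sgraph) (X Y : G -> int) above (a b c x : G) :
  diagram X Y above -> ~ filled 5 a b c x.
Proof.
move=> D [d [_ K F1 F2 F3]].
have odd := inside_odd D K.
have [Iabc|/negbTE nabc] := boolP (inside above a b c d).
  by apply: (inside_not_filled D K Iabc); apply: filled_around_le; split.
have outer u v w z : K4 u v w z -> inside above u v w z -> ~ filled 4 u w z v.
  move=> Ku Iu /= [e [ev Ke f1 f2 f3]].
  have Ku' : K4 u w v z by rewrite K4_swap23.
  have Iu' : inside above u w v z by rewrite (inside_swap23 D).
  have [Ie _] := inside_stack D Ku' Iu' Ke ev.
  by apply: (inside_not_filled D Ke Ie); split.
have [Ia|/negbTE na] := boolP (inside above b c d a).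
  apply: (outer b c d a) => //; first by rewrite K4_swap34 K4_swap23 K4_swap12.
  by apply/filled_swap23/filled_swap12.
have [Ib|/negbTE nb] := boolP (inside above a c d b).
  apply: (outer a c d b) => //; first by rewrite K4_swap34 K4_swap23.
  exact: filled_swap23.
move: odd; rewrite nabc na nb /= => Ic.
have Ic' : inside above a b d c by move: Ic; case: inside.
apply: (outer a b d c) => //; first by rewrite K4_swap34.
exact: filled_swap23.
Qed.

(** * Monotone curves *)

Section Monotone.
Variable R : realType.
Implicit Types (f g : R -> R * R) (h : R -> R).

Definition nondecreasing01 h := forall a b, 0 <= a -> a <= b -> b <= 1 ->
  h a <= h b.

Definition monotone01 h := nondecreasing01 h \/ nondecreasing01 (fun t => - h t).

Lemma monotone01_opp h : monotone01 h -> monotone01 (fun t => - h t).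
Proof.
case=> m; [right|left] => // a b a0 ab b1; rewrite !opprK; exact: m.
Qed.

(** A nonincreasing [h] with [h 0 <= h 1] is constant on the unit interval. *)
Lemma monotone01_nondecreasing h : monotone01 h -> h 0 <= h 1 ->
  nondecreasing01 h.
Proof.
case=> // m h01 a b a0 ab b1.
have := m _ _ (lexx 0) a0 (le_trans ab b1); have := m _ _ a0 ab b1.
have := m _ _ (le_trans a0 ab) b1 (lexx 1).
by rewrite !lerN2; lra.
Qed.

Lemma quadrant_monotone (i : 'I_4) (x y : R * R) : quadrant i x y ->
  (if (i == 0 :> nat) || (i == 3 :> nat) then x.1 <= y.1 else y.1 <= x.1) /\
  (if (i < 2)%N then x.2 <= y.2 else y.2 <= x.2).
Proof.
case: i => i lti [r [th [r0 /andP[/= th0 th1] ->]]] /=.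
(* Turning back by [i] right angles leaves an angle with nonnegative sine and cosine. *)
pose s := th - i%:R * (pi / 2); have thE : th = s + i%:R * (pi / 2).
  by rewrite subrK.
have s0 : 0 <= s by rewrite subr_ge0.
have s1 : s <= pi / 2.
  by rewrite lerBlDr (le_trans th1) // -natr1 mulrDl mul1r addrC.
have pi0 := pi_ge0 R.
have rc : 0 <= r * cos s.
  by rewrite mulr_ge0 //; apply: cos_ge0_pihalf; apply/andP; split; lra.
have rs : 0 <= r * sin s.
  by rewrite mulr_ge0 //; apply: sin_ge0_pi; apply/andP; split; lra.
have E2 : 2%:R * (pi / 2) = pi :> R by rewrite mulrC divfK.
have E3 : s + 3%:R * (pi / 2) = s + pi / 2 + pi by lra.
move: s rc rs thE E3 {s0 s1 th0 th1} => s rc rs -> E3.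
case: i lti E3 => [|[|[|[|]]]] //= _ E3.
- by rewrite mul0r addr0; split; lra.
- by rewrite mul1r cosDpihalf sinDpihalf; split; lra.
- by rewrite E2 cosDpi sinDpi; split; lra.
- by rewrite E3 cosDpi sinDpi cosDpihalf sinDpihalf; split; lra.
Qed.

(* The point [y] has argument [acos (dx / r)], which ranges over [[0, pi]]. *)
Lemma quadrant_upper (x y : R * R) (i : 'I_4) : x.2 <= y.2 ->
  (i == 0 :> nat) && (x.1 <= y.1) || (i == 1 :> nat) && (y.1 <= x.1) ->
  quadrant i x y.
Proof.
case: x y => x1 x2 [y1 y2] /= h2 hi.
pose u := y1 - x1; pose v := y2 - x2; pose r := Num.sqrt (u ^+ 2 + v ^+ 2).
have v0 : 0 <= v by rewrite subr_ge0.
have uv0 : 0 <= u ^+ 2 + v ^+ 2 by rewrite addr_ge0 ?sqr_ge0.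
have r0 : 0 <= r by apply: sqrtr_ge0.
have r2 : r ^+ 2 = u ^+ 2 + v ^+ 2 by rewrite sqr_sqrtr.
(* Coincident points determine no argument; the lower end of the angular range serves. *)
have [re|rn] := eqVneq r 0.
  have u0 : u = 0.
    by apply/eqP; rewrite -sqrf_eq0; move: r2 (sqr_ge0 u) (sqr_ge0 v); rewrite re; nra.
  have v00 : v = 0.
    by apply/eqP; rewrite -sqrf_eq0; move: r2 (sqr_ge0 u) (sqr_ge0 v); rewrite re; nra.
  exists 0, (i%:R * (pi / 2)); split => //=.
    by rewrite lexx ler_wpM2r ?ler_nat // divr_ge0 // pi_ge0.
  by rewrite !mul0r !addr0; congr (_, _); move: u0 v00; rewrite /u /v; lra.
have rp : 0 < r by rewrite lt_neqAle eq_sym rn.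
have ur1 : -1 <= u / r <= 1.
  by rewrite ler_pdivlMr // ler_pdivrMr //; apply/andP; split; nra.
exists r, (acos (u / r)); split => //=; last first.
  rewrite acosK ?in_itv //= sin_acos // mulrCA divff // mulr1.
  have -> : r * Num.sqrt (1 - (u / r) ^+ 2) = v.
    rewrite -[X in X * _](ger0_norm r0) -sqrtr_sqr -sqrtrM ?sqr_ge0 //.
    have -> : r ^+ 2 * (1 - (u / r) ^+ 2) = r ^+ 2 - u ^+ 2 by field.
    by rewrite r2 addrAC subrr add0r sqrtr_sqr ger0_norm.
  by rewrite /u /v; congr (_, _); ring.
have a0 := acos_ge0 ur1; have a1 := acos_lepi ur1.
have ac : cos (acos (u / r)) = u / r by rewrite acosK ?in_itv.
have pi0 := pi_gt0 R.
case/orP: hi => /andP[/eqP ->] h1.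
  rewrite mul0r a0 mul1r /= leNgt; apply/negP => h.
  have : 0 < sin (acos (u / r) - pi / 2).
    by apply: sin_gt0_pi; apply/andP; split; lra.
  rewrite sinBpihalf ac oppr_gt0 ltNge divr_ge0 //.
  by rewrite /u subr_ge0.
have -> : 2%:R * (pi / 2) = pi :> R by rewrite mulrC divfK.
rewrite mul1r a1 andbT leNgt; apply/negP => h.
have : 0 < cos (acos (u / r)) by apply: cos_gt0_pihalf; apply/andP; split; lra.
rewrite ac ltNge ler_pdivrMr // mul0r.
by rewrite /u subr_le0 h1.
Qed.

End Monotone.

(** * Vertical order of disjoint monotone curves *)

Section Separation.
Variable R : realType.
Implicit Types (f g : R -> R * R) (A B : set R).

Let clamp (t : R) : R := Num.max 0 (Num.min 1 t).

Let clamp01 t : 0 <= clamp t <= 1.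
Proof. by rewrite /clamp le_max lexx /= ge_max ler01 ge_min lexx. Qed.

Let clamp_id t : 0 <= t <= 1 -> clamp t = t.
Proof. by case/andP=> t0 t1; rewrite /clamp min_r // max_r. Qed.

Let continuous_clamp : continuous clamp.
Proof.
move=> t; apply: (@continuous_max R R); first exact: cst_continuous.
by apply: (@continuous_min R R); [exact: cst_continuous | exact: id].
Qed.

(** Clamping the parameter to the unit interval turns continuity within it into global
    continuity. *)
Lemma curve_extension f : is_curve f ->
  exists2 F : R -> R * R, continuous F & forall t, 0 <= t <= 1 -> F t = f t.
Proof.
move=> cf; exists (f \o clamp); last by move=> t /clamp_id /= ->.
move=> t; have t01 : `[0, 1]%classic (clamp t) by rewrite /= in_itv /= clamp01.
move/subspace_continuousP: cf => /(_ (clamp t) t01) cf.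
apply: (@cvg_comp _ _ _ clamp f _ _ _ _ cf) => P.
move=> hP; have := @continuous_clamp t _ hP; rewrite /nbhs /=.
apply: (@filterS _ (nbhs t)) => s /=; apply; rewrite in_itv /=; exact: clamp01.
Qed.

(** Within the segment [A] is the complement of [B], hence both open and closed, and connectedness
    makes it everything. *)
Lemma segment_not_closed_cover (a b : R) A B : closed A -> closed B ->
  (forall t, a <= t <= b -> A t \/ B t) ->
  (forall t, a <= t <= b -> A t -> B t -> False) ->
  a <= b -> (A a /\ B b) \/ (A b /\ B a) -> False.
Proof.
move=> cA cB AB dAB ab Aab.
have itvE t : `[a, b]%classic t <-> a <= t <= b by rewrite /= in_itv.
have E : (`[a, b] `&` A = `[a, b])%classic.
  apply: (@segment_connected R a b).
  - have [[Aa _]|[Ab _]] := Aab; [exists a|exists b]; split=> //;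
      by apply/itvE; rewrite lexx ab.
  - exists (~` B)%classic; first by rewrite openC.
    apply/seteqP; split=> t [/[dup] /itvE tab ? h]; split=> //.
      by move=> Bt; apply: (dAB t).
    by have [] := AB t tab.
  - by exists A.
have AE t : a <= t <= b -> A t.
  by move=> /itvE tab; have : (`[a, b] `&` A)%classic t by [rewrite E]; case.
case: Aab => -[_ Bt]; [apply: (dAB b) => //|apply: (dAB a) => //];
  by do ?apply: AE; rewrite lexx ab.
Qed.

(** The set is the projection of a compact part of the unit square of pairs of parameters. *)
Lemma fiber_closed (F G : R -> R * R) (C : set R) :
  continuous F -> continuous G -> closed C ->
  closed [set t : R | 0 <= t <= 1 /\ exists2 s : R, 0 <= s <= 1
     & (G s).1 = (F t).1 /\ C ((F t).2 - (G s).2)].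
Proof.
move=> cF cG cC.
have c1 (H : R -> R * R) : continuous H -> continuous (fun t => (H t).1).
  by move=> cH t; apply: cvg_comp (cH t) _; apply: cvg_fst.
have c2 (H : R -> R * R) : continuous H -> continuous (fun t => (H t).2).
  by move=> cH t; apply: cvg_comp (cH t) _; apply: cvg_snd.
pose h1 (p : R * R) : R := (F p.1).1 - (G p.2).1.
pose h2 (p : R * R) : R := (F p.1).2 - (G p.2).2.
have ch1 : continuous h1.
  move=> p; apply: cvgB.
    by apply: (@continuous_comp _ _ _ fst (fun t => (F t).1)); [exact: cvg_fst | exact: c1].
  by apply: (@continuous_comp _ _ _ snd (fun t => (G t).1)); [exact: cvg_snd | exact: c1].
have ch2 : continuous h2.
  move=> p; apply: cvgB.
    by apply: (@continuous_comp _ _ _ fst (fun t => (F t).2)); [exact: cvg_fst | exact: c2].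
  by apply: (@continuous_comp _ _ _ snd (fun t => (G t).2)); [exact: cvg_snd | exact: c2].
pose K := (((`[0, 1]%classic : set R) `*` (`[0, 1]%classic : set R)) `&`
  (h1 @^-1` [set 0] `&` h2 @^-1` C))%classic.
have cK : compact K.
  have cS := compact_setX (@segment_compact R 0 1) (@segment_compact R 0 1).
  apply: (subclosed_compact _ cS); last by move=> p [].
  apply: closedI; last apply: closedI.
  - by apply: (compact_closed _ cS); exact: norm_hausdorff.
  - by apply: closed_comp => //; apply: closed_eq.
  - by apply: closed_comp.
have -> : [set t : R | 0 <= t <= 1 /\ exists2 s : R, 0 <= s <= 1
     & (G s).1 = (F t).1 /\ C ((F t).2 - (G s).2)]%classic = (fst @` K)%classic.
  apply/seteqP; split=> t /=.
    case=> t01 [s s01 [h hC]]; exists (t, s) => //; rewrite /K /h1 /h2 /=.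
    by rewrite !in_itv /= h subrr.
  case=> -[t' s] []; rewrite /h1 /h2 /= !in_itv /= => -[t01 s01] [/eqP h hC] <-.
  by split=> //; exists s => //; split=> //; apply/esym/eqP; rewrite -subr_eq0.
apply: compact_closed; first exact: norm_hausdorff.
by apply: continuous_compact => //; apply: continuous_subspaceT => p; apply: cvg_fst.
Qed.

End Separation.

Section Curves.
Variable R : realType.
Implicit Types (f g : R -> R * R).

Lemma continuous_between (h : R -> R) (s s' v : R) : continuous h ->
  0 <= s <= 1 -> 0 <= s' <= 1 -> h s <= v <= h s' ->
  exists2 c, [/\ 0 <= c <= 1, Num.min s s' <= c & c <= Num.max s s'] & h c = v.
Proof.
move=> ch s01 s'01 v01.
have ch' a b : {within `[a, b], continuous h}%classic.
  exact: continuous_subspaceT.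
have [ss'|s's] := leP s s'.
  have [|c] := IVT ss' (ch' s s') (v := v).
    by rewrite ge_min le_max; case/andP: v01 => -> ->; rewrite orbT.
  rewrite in_itv /= => /andP[c1 c2] hc; exists c => //; split=> //.
  by move: s01 s'01; lra.
have [|c] := IVT (ltW s's) (ch' s' s) (v := v).
  by rewrite ge_min le_max; case/andP: v01 => -> ->; rewrite orbT.
rewrite in_itv /= => /andP[c1 c2] hc; exists c => //; split=> //.
by move: s01 s'01; lra.
Qed.

Lemma continuous_fst_snd f : continuous f ->
  continuous (fun t => (f t).1) /\ continuous (fun t => (f t).2).
Proof.
by move=> cf; split=> t; apply: cvg_comp (cf t) _; [exact: cvg_fst|exact: cvg_snd].
Qed.

Lemma curve_abscissa f (t t' v : R) : is_curve f ->
  0 <= t <= 1 -> 0 <= t' <= 1 -> (f t).1 <= v <= (f t').1 ->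
  exists2 s, 0 <= s <= 1 & (f s).1 = v.
Proof.
move=> /curve_extension[F cF EF] t01 t'01.
rewrite -!EF // => h; have [c1 _] := continuous_fst_snd cF.
by have [c [c01 _ _] <-] := continuous_between c1 t01 t'01 h; exists c; rewrite -?EF.
Qed.

(** Between [t] and [t'] the abscissa is constant, so the intermediate value theorem for the
    ordinate yields [p]. *)
Lemma curve_through f (t t' : R) (p : R * R) : is_curve f ->
  nondecreasing01 (fun t => (f t).1) ->
  0 <= t <= 1 -> 0 <= t' <= 1 -> (f t).1 = p.1 -> (f t').1 = p.1 ->
  (f t).2 <= p.2 <= (f t').2 -> exists2 s, 0 <= s <= 1 & f s = p.
Proof.
move=> /curve_extension[F cF EF] m t01 t'01 ft ft'.
rewrite -!EF // => h; have [_ c2] := continuous_fst_snd cF.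
have [c [c01 lc cu] Fc] := continuous_between c2 t01 t'01 h; exists c => //.
rewrite [LHS]surjective_pairing [RHS]surjective_pairing; congr (_, _).
  case/andP: c01 t01 t'01 => c0 c1 /andP[t0 t1] /andP[t'0 t'1].
  apply/eqP; rewrite eq_le; move: lc cu; case: (leP t t') => tt' lc cu.
    by rewrite -{1}ft' -ft !m.
  by rewrite -{1}ft -ft' !m.
by rewrite -EF.
Qed.

(** Call [t] of the first kind if some point of [g] on the vertical line through [f t] is at most as
    high as [f t], and of the second if some is at least as high. Both kinds are closed and cover
    the parameters between [t1] and [t2]; a common [t] would put [f t] on [g] by [curve_through]. A
    change of order would thus disconnect a segment. *)
Lemma curves_same_side f g (t1 s1 t2 s2 : R) :
  is_curve f -> is_curve g ->
  nondecreasing01 (fun t => (f t).1) -> nondecreasing01 (fun t => (g t).1) ->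
  (forall s t, 0 <= s <= 1 -> 0 <= t <= 1 -> f s <> g t) ->
  0 <= t1 <= 1 -> 0 <= s1 <= 1 -> 0 <= t2 <= 1 -> 0 <= s2 <= 1 ->
  (f t1).1 = (g s1).1 -> (f t2).1 = (g s2).1 ->
  ((g s1).2 < (f t1).2) = ((g s2).2 < (f t2).2).
Proof.
move=> cf cg mf mg fg t101 s101 t201 s201 e1 e2.
have ne t s : 0 <= t <= 1 -> 0 <= s <= 1 -> (f t).1 = (g s).1 -> (f t).2 != (g s).2.
  move=> t01 s01 e; apply/eqP => e'; apply: (fg t s) => //.
  by rewrite [LHS]surjective_pairing e e' -surjective_pairing.
suff key : ((g s1).2 < (f t1).2 /\ (f t2).2 < (g s2).2) \/
    ((g s2).2 < (f t2).2 /\ (f t1).2 < (g s1).2) -> False.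
  have := ne _ _ t101 s101 e1; have := ne _ _ t201 s201 e2.
  case: (ltgtP (f t1).2 (g s1).2) => // h1; case: (ltgtP (f t2).2 (g s2).2) => // h2;
    by case: key; auto.
move=> H.
have [F cF EF] := curve_extension cf; have [K cK EK] := curve_extension cg.
pose a := Num.min t1 t2; pose b := Num.max t1 t2.
have a0 : 0 <= a by rewrite le_min; lra.
have b1 : b <= 1 by rewrite ge_max; lra.
have ab01 t : a <= t <= b -> 0 <= t <= 1 by lra.
have cA := fiber_closed cF cK (@closed_ge R 0).
have cB := fiber_closed cF cK (@closed_le R 0).
apply: (segment_not_closed_cover (a := a) (b := b) cA cB).
- move=> t /[dup] tab /ab01 t01.
  have [s s01 gs] : exists2 s, 0 <= s <= 1 & (g s).1 = (f t).1.
    have := mf; rewrite /nondecreasing01 => m.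
    have [tt|tt] := leP t1 t2; move: tab; rewrite /a /b.
      rewrite (min_l tt) (max_r tt) => /andP[l r].
      by apply: (curve_abscissa cg s101 s201); rewrite -e1 -e2 !m //; lra.
    rewrite (min_r (ltW tt)) (max_l (ltW tt)) => /andP[l r].
    by apply: (curve_abscissa cg s201 s101); rewrite -e1 -e2 !m //; lra.
  rewrite /=; have [h|h] := leP (g s).2 (f t).2; [left|right]; split=> //;
    exists s => //; rewrite !EF ?EK //; split=> //.
    by rewrite subr_ge0.
  by rewrite subr_le0 ltW.
- move=> t tab /= [t01 [s s01 []]] + + [_ [s' s'01 []]].
  rewrite !EF ?EK // subr_ge0 subr_le0 => gs h gs' h'.
  have [|c c01 gc] := curve_through cg mg s01 s'01 gs gs'; first by rewrite h.
  exact: (fg t c).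
- by rewrite /a /b ge_min le_max lexx.
- have AP t s : 0 <= t <= 1 -> 0 <= s <= 1 -> (f t).1 = (g s).1 -> (g s).2 < (f t).2 ->
     [set t : R | 0 <= t <= 1 /\ exists2 s : R, 0 <= s <= 1
     & (K s).1 = (F t).1 /\ [set y | 0 <= y]%classic ((F t).2 - (K s).2)]%classic t.
    by move=> t01 s01 e h; split=> //; exists s => //=; rewrite !EF ?EK // e subr_ge0 ltW.
  have BP t s : 0 <= t <= 1 -> 0 <= s <= 1 -> (f t).1 = (g s).1 -> (f t).2 < (g s).2 ->
     [set t : R | 0 <= t <= 1 /\ exists2 s : R, 0 <= s <= 1
     & (K s).1 = (F t).1 /\ [set y | y <= 0]%classic ((F t).2 - (K s).2)]%classic t.
    by move=> t01 s01 e h; split=> //; exists s => //=; rewrite !EF ?EK // e subr_le0 ltW.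
  have [tt|tt] := leP t1 t2; rewrite /a /b.
    rewrite (min_l tt) (max_r tt); case: H => -[h h']; [left|right]; split.
    - exact: AP h.
    - exact: BP h'.
    - exact: AP h.
    - exact: BP h'.
  rewrite (min_r (ltW tt)) (max_l (ltW tt)); case: H => -[h h']; [right|left]; split.
  - exact: AP h.
  - exact: BP h'.
  - exact: AP h.
  - exact: BP h'.
Qed.

Lemma curve_cat_nondecreasing (h : R * R -> R) f g :
  nondecreasing01 (h \o f) -> nondecreasing01 (h \o g) -> h (f 1) <= h (g 0) ->
  nondecreasing01 (h \o curve_cat f g).
Proof.
move=> mf mg fg a b a0 ab b1; rewrite /curve_cat /=.
case: (leP a (1 / 2)) => ha; case: (leP b (1 / 2)) => hb; last 2 first.
- by exfalso; lra.
- by apply: mg; lra.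
- by apply: mf; lra.
apply: (le_trans (y := h (f 1))); first by apply: mf; lra.
by apply: (le_trans fg); apply: mg; lra.
Qed.

End Curves.

(** * Integer ranks of a finite strict linear order *)

Section Rank.
Variables (T : finType) (lt : rel T).
Hypotheses (lt_irr : irreflexive lt) (lt_trans : transitive lt).
Hypothesis lt_total : forall u v, u != v -> lt u v || lt v u.

Definition rank (v : T) : int := Posz #|[pred u | lt u v]|.

Lemma rank_lt u v : (rank u < rank v) = lt u v.
Proof.
have mono x y : lt x y -> rank x < rank y.
  move=> xy; rewrite /rank ltz_nat; apply/proper_card/properP; split.
    by apply/fintype.subsetP => z; rewrite !inE => /lt_trans; apply.
  by exists x; rewrite !inE // lt_irr.
have [->|/lt_total/orP[uv|vu]] := eqVneq u v; first by rewrite ltxx lt_irr.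
  by rewrite uv mono.
rewrite (lt_gtF (mono _ _ vu)); apply/esym/negbTE/negP => uv.
by have := lt_trans uv vu; rewrite lt_irr.
Qed.

Lemma rank_inj : injective rank.
Proof.
move=> u v e; apply/eqP; apply: contraT => /lt_total.
by rewrite -!rank_lt e ltxx.
Qed.

End Rank.

(** * The diagram of an obstacle embedding *)

Section Embedding.
Variables (R : realType) (G : sgraph) (phi : G -> R * R).
Variable c : G -> G -> R -> R * R.
Hypothesis emb : plane_delta2_obstacle_embedding phi c.
Implicit Types u v w z : G.

Let plane : plane_drawing phi c := obstacle_plane emb.

(* Ties are broken as by a small perturbation of the two axes: among vertices on
   a common vertical line the higher one comes first, and among vertices on a
   common horizontal line the left one comes first. *)
Definition left_of : rel G := fun u v =>
  ((phi u).1 < (phi v).1) || ((phi u).1 == (phi v).1) && ((phi v).2 < (phi u).2).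

Definition below : rel G := fun u v =>
  ((phi u).2 < (phi v).2) || ((phi u).2 == (phi v).2) && ((phi u).1 < (phi v).1).

Let neq_phi u v : u != v -> ((phi u).1 != (phi v).1) || ((phi u).2 != (phi v).2).
Proof.
apply: contra_neqT; rewrite negb_or !negbK => /andP[/eqP e1 /eqP e2].
apply: (drawing_inj plane).
by rewrite [LHS]surjective_pairing e1 e2 -surjective_pairing.
Qed.

Definition absc : G -> int := rank left_of.
Definition ordi : G -> int := rank below.

Lemma left_of_total u v : u != v -> left_of u v || left_of v u.
Proof. by move=> /neq_phi; rewrite /left_of; case: ltgtP => //=; case: ltgtP. Qed.

Lemma below_total u v : u != v -> below u v || below v u.
Proof. by move=> /neq_phi; rewrite /below; case: ltgtP => //=; case: ltgtP. Qed.

Lemma absc_lt u v : (absc u < absc v) = left_of u v.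
Proof.
apply: rank_lt.
- by move=> x; rewrite /left_of !ltxx andbF.
- by move=> y x z; rewrite /left_of; lra.
- exact: left_of_total.
Qed.

Lemma ordi_lt u v : (ordi u < ordi v) = below u v.
Proof.
apply: rank_lt.
- by move=> x; rewrite /below !ltxx andbF.
- by move=> y x z; rewrite /below; lra.
- exact: below_total.
Qed.

Lemma absc_le u v : absc u < absc v -> (phi u).1 <= (phi v).1.
Proof. by rewrite absc_lt /left_of; lra. Qed.

Lemma ordi_le u v : ordi u < ordi v -> (phi u).2 <= (phi v).2.
Proof. by rewrite ordi_lt /below; lra. Qed.

Let mono_coord u v : adj u v ->
  monotone01 (fun t => (c u v t).1) /\ monotone01 (fun t => (c u v t).2).
Proof.
move=> uv; have [i mi] := obstacle_monotone emb uv.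
have q a b a0 ab b1 := quadrant_monotone (mi a b a0 ab b1).
split; rewrite /monotone01.
  case h: ((i == 0 :> nat) || (i == 3 :> nat)) in q; [left|right];
    by move=> a b a0 ab b1; have [] := q a b a0 ab b1; rewrite ?lerN2.
case h: (i < 2)%N in q; [left|right];
  by move=> a b a0 ab b1; have [_] := q a b a0 ab b1; rewrite ?lerN2.
Qed.

Let nondecr_fst u v : adj u v -> (phi u).1 <= (phi v).1 ->
  nondecreasing01 (fun t => (c u v t).1).
Proof.
move=> uv h; apply: monotone01_nondecreasing; first by case: (mono_coord uv).
by rewrite (drawing_source plane) // (drawing_target plane).
Qed.

Let nondecr_snd u v : adj u v -> (phi u).2 <= (phi v).2 ->
  nondecreasing01 (fun t => (c u v t).2).
Proof.
move=> uv h; apply: monotone01_nondecreasing; first by case: (mono_coord uv).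
by rewrite (drawing_source plane) // (drawing_target plane).
Qed.

Let nonincr_fst u v : adj u v -> (phi v).1 <= (phi u).1 ->
  nondecreasing01 (fun t => - (c u v t).1).
Proof.
move=> uv h; apply: monotone01_nondecreasing.
  by apply: monotone01_opp; case: (mono_coord uv).
by rewrite (drawing_source plane) // (drawing_target plane) // lerN2.
Qed.

Let nonincr_snd u v : adj u v -> (phi v).2 <= (phi u).2 ->
  nondecreasing01 (fun t => - (c u v t).2).
Proof.
move=> uv h; apply: monotone01_nondecreasing.
  by apply: monotone01_opp; case: (mono_coord uv).
by rewrite (drawing_source plane) // (drawing_target plane) // lerN2.
Qed.

Let ordinate_range u v t : adj u v -> 0 <= t <= 1 ->
  ((phi u).2 <= (c u v t).2 <= (phi v).2) || ((phi v).2 <= (c u v t).2 <= (phi u).2).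
Proof.
move=> uv /andP[t0 t1]; have [h|/ltW h] := leP (phi u).2 (phi v).2.
  have m := nondecr_snd uv h; have := m _ _ (lexx 0) t0 t1.
  have := m _ _ t0 t1 (lexx 1).
  by rewrite (drawing_source plane) // (drawing_target plane) // => -> ->.
have m := nonincr_snd uv h; have := m _ _ (lexx 0) t0 t1.
have := m _ _ t0 t1 (lexx 1).
rewrite (drawing_source plane) // (drawing_target plane) // !lerN2 => -> ->.
by rewrite orbT.
Qed.

Let off_curve u v w t : adj u v -> w != u -> w != v -> 0 <= t <= 1 ->
  c u v t <> phi w.
Proof.
move=> uv wu wv t01 e.
by have [/eqP|/eqP] := drawing_vertex plane uv t01 e; apply/negP.
Qed.

Definition passes_above u v w : bool :=
  [&& adj u v, between (absc u) (absc v) (absc w) &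
   `[< exists2 t, 0 <= t <= 1 &
       (c u v t).1 = (phi w).1 /\ (phi w).2 < (c u v t).2 >]].

Lemma passes_above_sym u v w : passes_above u v w = passes_above v u w.
Proof.
suff imp x y : passes_above x y w -> passes_above y x w.
  by apply/idP/idP; apply: imp.
case/and3P=> xy b /asboolP[t t01 h]; apply/and3P; split.
- by rewrite adj_sym.
- by move: b; rewrite /between orbC.
apply/asboolP; exists (1 - t); first by move: t01; lra.
by rewrite (drawing_rev plane xy) ?subKr //; move: t01; lra.
Qed.

Let between_lt u v w : absc u < absc w -> absc w < absc v ->
  between (absc u) (absc v) (absc w).
Proof. by rewrite /between => -> ->. Qed.

Let absc_neq u v : absc u < absc v -> u != v.
Proof. by apply: contraTneq => ->; rewrite ltxx. Qed.

Let curve_over u v w : adj u v -> absc u < absc w -> absc w < absc v ->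
  exists2 t, 0 <= t <= 1 & (c u v t).1 = (phi w).1.
Proof.
move=> uv uw wv; apply: (curve_abscissa (drawing_curve plane uv)
  (t := 0) (t' := 1)); rewrite ?lexx ?ler01 //.
by rewrite (drawing_source plane) // (drawing_target plane) // !absc_le.
Qed.

(** The curve may contain a vertical piece on the line through [phi w], but it avoids [phi w], so by
    [curve_through] any one of its points there decides. *)
Lemma passes_aboveE u v w t : adj u v -> absc u < absc w -> absc w < absc v ->
  0 <= t <= 1 -> (c u v t).1 = (phi w).1 ->
  passes_above u v w = ((phi w).2 < (c u v t).2).
Proof.
move=> uv uw wv t01 ct; rewrite /passes_above uv between_lt //=.
apply/asboolP/idP => [[t' t'01 [ct' h]]|h]; last by exists t.
rewrite ltNge; apply/negP => h'.
have wu : w != u by rewrite eq_sym absc_neq.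
have xuv : (phi u).1 <= (phi v).1 by apply: absc_le; apply: lt_trans wv.
have [|s s01] := curve_through (drawing_curve plane uv)
  (nondecr_fst uv xuv) t01 t'01 ct ct'; first by rewrite h' ltW.
exact: (off_curve uv wu (absc_neq wv) s01).
Qed.

Lemma passes_above_low u v w : adj u v -> between (absc u) (absc v) (absc w) ->
  ordi w < ordi u -> ordi w < ordi v -> passes_above u v w.
Proof.
move=> uv; wlog uv_lt : u v uv / absc u < absc w /\ absc w < absc v.
  move=> IH /orP[/andP[uw wv] hu hv|/andP[vw wu] hu hv].
    by apply: IH => //; apply: between_lt.
  by rewrite passes_above_sym; apply: IH => //;
    [rewrite adj_sym | apply: between_lt].
case: uv_lt => uw wv _ wu' wv'.
have [t t01 ct] := curve_over uv uw wv.
rewrite (passes_aboveE uv uw wv t01 ct) lt_neqAle; apply/andP; split.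
  apply/eqP => e; have wu : w != u by rewrite eq_sym absc_neq.
  apply: (off_curve uv wu (absc_neq wv) t01).
  by rewrite [LHS]surjective_pairing ct -e -surjective_pairing.
by move: (ordinate_range uv t01) (ordi_le wu') (ordi_le wv'); lra.
Qed.

Lemma passes_above_high u v w : adj u v ->
  ordi u < ordi w -> ordi v < ordi w -> ~~ passes_above u v w.
Proof.
move=> uv /ordi_le uw /ordi_le vw; apply/negP => /and3P[_ _ /asboolP].
by move=> [t t01 [_ h]]; move: (ordinate_range uv t01); lra.
Qed.

Let passes_above_left u v w : absc w < absc u -> absc w < absc v ->
  passes_above u v w = false.
Proof.
move=> wu wv; apply/negbTE/negP => /and3P[_ + _].
by move: wu wv; rewrite /between; clear; lia.
Qed.

Let passes_above_right u v w : absc u < absc w -> absc v < absc w ->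
  passes_above u v w = false.
Proof.
move=> wu wv; apply/negbTE/negP => /and3P[_ + _].
by move: wu wv; rewrite /between; clear; lia.
Qed.

(** By symmetry [u] may be taken leftmost and [w] left of [z]. If the spans are disjoint, all terms
    vanish. Otherwise the common span begins at [w] and ends at [v] or [z]; the curves share no
    endpoint, hence do not meet, and [curves_same_side] compares their order at its two ends. *)
Lemma passes_above_cross u v w z : adj u v -> adj w z ->
  u != w -> u != z -> v != w -> v != z ->
  passes_above u v w (+) passes_above u v z
    (+) (passes_above w z u (+) passes_above w z v)
  = between (absc u) (absc v) (absc w) (+) between (absc u) (absc v) (absc z).
Proof.
have absc_inj : injective absc by apply: (rank_inj _ _ left_of_total);
  [move=> x; rewrite /left_of !ltxx andbF | move=> y x z'; rewrite /left_of; lra].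
have total x y : x != y -> absc x < absc y \/ absc y < absc x.
  move=> xy; have : absc x != absc y by apply: contra_neq xy => /absc_inj.
  by case: ltgtP; auto.
have betC a b d : between a b d = between b a d by rewrite /between orbC.
move=> uv wz uw uz vw vz.
wlog lt_uv : u v uv uw uz vw vz / absc u < absc v.
  move=> IH; case: (total u v (adj_neq uv)) => h; first exact: IH.
  have := IH v u; rewrite (adj_sym v u) => /(_ uv vw vz uw uz h).
  rewrite !(betC _ (absc u)) => <-.
  by rewrite !(passes_above_sym v u) (addbC (passes_above w z v)).
wlog lt_wz : w z wz uw uz vw vz / absc w < absc z.
  move=> IH; case: (total w z (adj_neq wz)) => h; first exact: IH.
  have := IH z w; rewrite (adj_sym z w) => /(_ wz uz uw vz vw h).
  rewrite (addbC (between _ _ (absc w))) => <-.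
  by rewrite !(passes_above_sym z w) (addbC (passes_above u v z)).
wlog lt_uw : u v w z uv wz uw uz vw vz lt_uv lt_wz / absc u < absc w.
  move=> IH; case: (total u w uw) => h; first exact: IH.
  have := IH w z u v wz uv; rewrite 2!(eq_sym w) 2!(eq_sym z).
  move=> /(_ uw vw uz vz lt_wz lt_uv h).
  (* Exchanging the two edges permutes the left-hand side and, by [between_cross], preserves the
     right-hand side. *)
  have neq x y : x != y -> absc x != absc y by apply: contra_neq => /absc_inj.
  by rewrite -between_cross ?neq // => <-; rewrite addbC.
have lt_uz := lt_trans lt_uw lt_wz.
have [lt_vw|lt_wv] : absc v < absc w \/ absc w < absc v by apply: total.
  have lt_vz := lt_trans lt_vw lt_wz.
  rewrite (passes_above_right lt_uw lt_vw) (passes_above_right lt_uz lt_vz).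
  rewrite (passes_above_left lt_uw lt_uz) (passes_above_left lt_vw lt_vz) /=.
  by move: lt_uw lt_uz lt_vw lt_vz; rewrite /between; clear; lia.
have [t1 t101 e1] := curve_over uv lt_uw lt_wv.
have xuv := absc_le lt_uv; have xwz := absc_le lt_wz.
have disj s t : 0 <= s <= 1 -> 0 <= t <= 1 -> c u v s <> c w z t.
  move=> s01 t01 e; have [|x] := drawing_cross plane uv wz _ s01 t01 e.
    apply/negP => /eqP/setP/(_ u).
    by rewrite !inE eqxx (negPf uw) (negPf uz).
  rewrite !inE => /andP[/orP[]/eqP -> /orP[]]/eqP h;
    by move: uw uz vw vz; rewrite h eqxx.
have c00 := drawing_source plane wz.
have i00 : 0 <= (0 : R) <= 1 by rewrite lexx ler01.
have i11 : 0 <= (1 : R) <= 1 by rewrite lexx ler01.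
have e1' : (c u v t1).1 = (c w z 0).1 by rewrite c00.
have same t2 s2 t201 s201 := @curves_same_side R _ _ t1 0 t2 s2
  (drawing_curve plane uv) (drawing_curve plane wz) (nondecr_fst uv xuv)
  (nondecr_fst wz xwz) disj t101 i00 t201 s201 e1'.
rewrite (passes_aboveE uv lt_uw lt_wv t101 e1) (passes_above_left lt_uw) //.
have [lt_vz|lt_zv] : absc v < absc z \/ absc z < absc v by apply: total.
  have [s2 s201 e2] := curve_over wz lt_wv lt_vz.
  rewrite (passes_above_right lt_uz) // (passes_aboveE wz lt_wv lt_vz s201 e2).
  have -> : between (absc u) (absc v) (absc w) by apply: between_lt.
  have -> : between (absc u) (absc v) (absc z) = false.
    by move: lt_uz lt_vz; rewrite /between; clear; lia.
  have e2' : (c u v 1).1 = (c w z s2).1 by rewrite (drawing_target plane) // e2.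
  have := same 1 s2 i11 s201 e2'; rewrite c00 (drawing_target plane) // => ->.
  have : (c w z s2).2 != (phi v).2.
    apply/eqP => e; apply: (off_curve wz _ _ s201); [exact: vw|exact: vz|].
    by rewrite [LHS]surjective_pairing e2 e -surjective_pairing.
  by case: ltgtP.
have [t2 t201 e2] := curve_over uv lt_uz lt_zv.
rewrite (passes_above_right lt_wv) // (passes_aboveE uv lt_uz lt_zv t201 e2).
have e2' : (c u v t2).1 = (c w z 1).1 by rewrite (drawing_target plane wz) e2.
have := same t2 1 t201 i11 e2'; rewrite c00 (drawing_target plane) // => ->.
by rewrite !between_lt // addbb.
Qed.

Let path2 u v w : adj u v -> adj v w -> absc u != absc w ->
  delta2_monotone (curve_cat (c u v) (c v w)) -> adj u w.
Proof.
move=> uv vw uw; apply: (obstacle_path emb (p := [:: w])) => /=.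
  by rewrite uv vw.
rewrite !inE negb_or (adj_neq uv) (adj_neq vw) !andbT.
by apply: contra_neq uw => ->.
Qed.

Lemma embedding_rising u v w : adj u v -> adj v w -> absc u < absc v ->
  absc v < absc w -> ordi u < ordi v -> ordi v < ordi w -> adj u w.
Proof.
move=> uv vw Xuv Xvw Yuv Yvw.
apply: (path2 uv vw); first by rewrite lt_eqF // (lt_trans Xuv).
have joint : c u v 1 = c v w 0.
  by rewrite (drawing_target plane) // (drawing_source plane).
exists ord0 => a b a0 ab b1; apply: quadrant_upper.
  apply: (@curve_cat_nondecreasing R snd) => //; last by rewrite joint.
  - by apply: nondecr_snd => //; apply: ordi_le.
  - by apply: nondecr_snd => //; apply: ordi_le.
rewrite /= orbF; apply: (@curve_cat_nondecreasing R fst) => //; last by rewrite joint.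
- by apply: nondecr_fst => //; apply: absc_le.
- by apply: nondecr_fst => //; apply: absc_le.
Qed.

Lemma embedding_falling u v w : adj u v -> adj v w -> absc u < absc v ->
  absc v < absc w -> ordi v < ordi u -> ordi w < ordi v -> adj u w.
Proof.
move=> uv vw Xuv Xvw Yvu Ywv; rewrite adj_sym.
(* Traversed from [w] to [u], the path runs to the upper left, in the quadrant of index 1, which
   [quadrant_upper] covers. *)
rewrite adj_sym in uv; rewrite adj_sym in vw.
apply: (path2 vw uv); first by rewrite gt_eqF // (lt_trans Xuv).
have joint : c w v 1 = c v u 0.
  by rewrite (drawing_target plane) // (drawing_source plane).
exists (inord 1) => a b a0 ab b1; apply: quadrant_upper.
  apply: (@curve_cat_nondecreasing R snd) => //; last by rewrite joint.
  - by apply: nondecr_snd => //; apply: ordi_le.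
  - by apply: nondecr_snd => //; apply: ordi_le.
rewrite inordK //= -lerN2.
apply: (@curve_cat_nondecreasing R (fun p => - p.1)) => //; last by rewrite joint.
- by apply: nonincr_fst => //; apply: absc_le.
- by apply: nonincr_fst => //; apply: absc_le.
Qed.

Lemma embedding_diagram : diagram absc ordi passes_above.
Proof.
split.
- apply: (rank_inj _ _ left_of_total).
    by move=> x; rewrite /left_of !ltxx andbF.
  by move=> y x z; rewrite /left_of; lra.
- apply: (rank_inj _ _ below_total).
    by move=> x; rewrite /below !ltxx andbF.
  by move=> y x z; rewrite /below; lra.
- exact: passes_above_sym.
- by move=> u v w /and3P[].
- exact: passes_above_low.
- exact: passes_above_high.
- exact: passes_above_cross.
- exact: embedding_rising.
- exact: embedding_falling.
Qed.

End Embedding.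

(** * Straight-line drawings *)

Section Geometry.
Variable R : realType.
Implicit Types (p q a b c d z : R * R) (t s : R).

Definition segment p q t : R * R :=
  ((1 - t) * p.1 + t * q.1, (1 - t) * p.2 + t * q.2).

(** Twice the signed area of the triangle [p q z], positive if it is counterclockwise. *)
Definition det p q z : R :=
  (q.1 - p.1) * (z.2 - p.2) - (q.2 - p.2) * (z.1 - p.1).

Definition interior a b c z : bool :=
  [&& 0 < det a b z, 0 < det b c z & 0 < det c a z].

Definition centroid a b c : R * R := ((a.1 + b.1 + c.1) / 3, (a.2 + b.2 + c.2) / 3).

Definition on_segment p q z : Prop :=
  exists2 t : R, 0 <= t <= 1 & z = segment p q t.

Lemma segment_rev p q t : segment q p t = segment p q (1 - t).
Proof. by rewrite /segment subKr ![t * _ + _]addrC ![_ + t * _]addrC. Qed.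

Lemma on_segmentC p q z : on_segment p q z -> on_segment q p z.
Proof.
by case=> t t01 ->; exists (1 - t); rewrite 1?segment_rev ?subKr //; lra.
Qed.

Lemma segment0 p q : segment p q 0 = p.
Proof. by rewrite /segment subr0 !mul1r !mul0r !addr0 -surjective_pairing. Qed.

Lemma segment1 p q : segment p q 1 = q.
Proof. by rewrite /segment subrr !mul1r !mul0r !add0r -surjective_pairing. Qed.

Lemma det_cycle p q z : det q z p = det p q z.
Proof. by rewrite /det; ring. Qed.

Lemma det_swap p q z : det q p z = - det p q z.
Proof. by rewrite /det; ring. Qed.

Lemma det_pp p z : det p p z = 0.
Proof. by rewrite /det; ring. Qed.

Lemma det_pzp p z : det p z p = 0.
Proof. by rewrite /det; ring. Qed.

Lemma det_pqq p q : det p q q = 0.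
Proof. by rewrite /det; ring. Qed.

Lemma det_segment p q a b t :
  det p q (segment a b t) = (1 - t) * det p q a + t * det p q b.
Proof. by rewrite /det /segment /=; ring. Qed.

Lemma det_centroid p q a b c :
  det p q (centroid a b c) = (det p q a + det p q b + det p q c) / 3.
Proof. by rewrite /det /centroid /=; field. Qed.

Lemma interior_cycle a b c z : interior b c a z = interior a b c z.
Proof. by rewrite /interior; case: (_ < _); rewrite ?andbF ?andbT //= andbC. Qed.

Lemma centroid_cycle a b c : centroid b c a = centroid a b c.
Proof. by rewrite /centroid; congr (_, _); congr (_ / _); ring. Qed.

Lemma on_segment_det p q z : on_segment p q z -> det p q z = 0.
Proof. by case=> t _ ->; rewrite det_segment det_pzp det_pqq !mulr0 addr0. Qed.

(** Along the segment from [p] to [q'], [det p q] is [t * det p q q'], which vanishes only at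
    [p]. *)
Lemma segments_meet p q q' z : det p q q' != 0 ->
  on_segment p q z -> on_segment p q' z -> z = p.
Proof.
move=> dn /on_segment_det dz [t t01 zE]; move: dz.
rewrite zE det_segment det_pzp mulr0 add0r => /eqP.
by rewrite mulf_eq0 (negPf dn) orbF => /eqP ->; rewrite segment0.
Qed.

Section Centroid.
Variables a b c : R * R.
Hypothesis abc : 0 < det a b c.
Let d := centroid a b c.

Lemma det_centroid_gt0 : 0 < det a b d.
Proof. by rewrite det_centroid det_pzp det_pqq !add0r divr_gt0. Qed.

Lemma spoke_interior z : on_segment a d z -> z = a \/ interior a b c z.
Proof.
case=> t /andP[t0 t1] ->.
case: (ltgtP t 0) t0 => // [t0|->] _; last by left; rewrite segment0.
have tD : 0 < t * (det a b c / 3) by rewrite mulr_gt0 // divr_gt0.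
have sD : 0 <= (1 - t) * det a b c by apply: mulr_ge0; [rewrite subr_ge0 | apply: ltW].
right; rewrite /interior !det_segment !det_centroid !det_pzp !det_pqq.
have -> : det b c a = det a b c by rewrite det_cycle.
have -> : det c a b = det a b c by rewrite -det_cycle.
by apply/and3P; split; lra.
Qed.

(** By the two identities [det b c z] and [det c a z] both exceed [det a b z]. *)
Lemma interior_centroid z : interior a b d z -> interior a b c z.
Proof.
have bd : det b d z = (det b c z - det a b z) / 3.
  by rewrite /det /d /centroid /=; field.
have da : det d a z = (det c a z - det a b z) / 3.
  by rewrite /det /d /centroid /=; field.
by rewrite /interior bd da; lra.
Qed.

(** The two triangles lie on opposite sides of their common side [bd]. *)
Lemma interior_disjoint z : interior a b d z -> ~~ interior b c d z.
Proof.
case/and3P=> _ bd _; apply/negP => /and3P[_ _].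
by rewrite det_swap oppr_gt0; lra.
Qed.

End Centroid.

Lemma det_centroid_neq0 a b c : 0 < det a b c -> 
  let d := centroid a b c in
  [/\ det d a b != 0, det d b c != 0, det d c a != 0, det d b a != 0
    & det d c b != 0 /\ det d a c != 0].
Proof.
move=> abc d; have h1 := det_centroid_gt0 abc.
have bca : 0 < det b c a by rewrite det_cycle.
have cab : 0 < det c a b by rewrite det_cycle.
have h2 := det_centroid_gt0 bca; have h3 := det_centroid_gt0 cab.
rewrite (centroid_cycle b c a) in h3; rewrite (centroid_cycle a b c) in h2 h3.
rewrite -/d in h1 h2 h3.
have E q z : det d q z = det q z d by rewrite -(det_cycle d) -(det_cycle q).
rewrite !E (det_swap a b) (det_swap b c) (det_swap c a) !oppr_eq0.
by rewrite !gt_eqF.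
Qed.

Lemma continuous_segment p q : continuous (segment p q).
Proof.
move=> t.
have c0 (u v : R) :
    ((1 - s) * u + s * v @[s --> t] --> (1 - t) * u + t * v)%classic.
  apply: cvgD; apply: cvgM; (try exact: cvg_cst); last exact: cvg_id.
  by apply: cvgB; [exact: cvg_cst | exact: cvg_id].
exact: (cvg_pair (c0 p.1 q.1) (c0 p.2 q.2)).
Qed.

Lemma segment_inj p q : p != q -> injective (segment p q).
Proof.
move=> pq s t [] e1 e2; apply/eqP; apply: contraNT pq => st.
rewrite [p]surjective_pairing [q]surjective_pairing xpair_eqE.
have st0 : s - t != 0 by rewrite subr_eq0.
have key (x y : R) : (1 - s) * x + s * y = (1 - t) * x + t * y -> x = y.
  move=> e; apply: (mulfI st0); lra.
by rewrite (key _ _ e1) (key _ _ e2) !eqxx.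
Qed.

End Geometry.

(** * Straight-line plane drawings and their empty faces *)

Section Straight.
Variable R : realType.

Definition meet_at (G : sgraph) (phi : G -> R * R) (u w u' w' : G) z : Prop :=
  [\/ u = u' /\ w = w', u = w' /\ w = u' |
    exists v, [/\ v = u \/ v = w, v = u' \/ v = w' & z = phi v]].

Lemma meet_at_swap (G : sgraph) (phi : G -> R * R) u w u' w' z :
  meet_at phi u w u' w' z -> meet_at phi w u u' w' z.
Proof.
case=> [[-> ->]|[-> ->]|[v [h h' e]]];
  [by constructor 2 | by constructor 1 | constructor 3].
by exists v; split=> //; case: h; auto.
Qed.

Lemma meet_at_sym (G : sgraph) (phi : G -> R * R) u w u' w' z :
  meet_at phi u w u' w' z -> meet_at phi u' w' u w z.
Proof.
case=> [[-> ->]|[-> ->]|[v [h h' e]]];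
  [by constructor 1 | by constructor 2 | constructor 3].
by exists v.
Qed.

Record straight (G : sgraph) (phi : G -> R * R) : Prop := Straight {
  straight_inj : injective phi;
  straight_vertex u w v : adj u w -> on_segment (phi u) (phi w) (phi v) ->
    v = u \/ v = w;
  straight_cross u w u' w' z : adj u w -> adj u' w' ->
    on_segment (phi u) (phi w) z -> on_segment (phi u') (phi w') z ->
    meet_at phi u w u' w' z
}.

Lemma straight_planar (G : sgraph) (phi : G -> R * R) :
  straight phi -> planar R G.
Proof.
case=> inj vert cross; exists phi, (fun u w => segment (phi u) (phi w)); split=> //.
- by move=> u w _; apply: continuous_subspaceT; apply: continuous_segment.
- by move=> u w _; rewrite segment0.
- by move=> u w _; rewrite segment1.
- by move=> u w _ t _; rewrite segment_rev.
- move=> u w uw s t _ _; apply: segment_inj.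
  by apply: contraTneq uw => /inj ->; rewrite adj_irrefl.
- by move=> u w uw v t t01 e; apply: vert => //; exists t.
- move=> u w u' w' uw u'w' ne s t s01 t01 e.
  have on : on_segment (phi u) (phi w) (segment (phi u) (phi w) s) by exists s.
  have on' : on_segment (phi u') (phi w') (segment (phi u) (phi w) s).
    by exists t.
  have [[e1 e2]|[e1 e2]|[v [h h' ->]]] := cross _ _ _ _ _ uw u'w' on on'.
  + by rewrite e1 e2 eqxx in ne.
  + by rewrite e1 e2 finset.setUC eqxx in ne.
  exists v => //; rewrite !inE.
  by apply/andP; split; apply/orP; [case: h|case: h'] => ->; auto.
Qed.

Record face (G : sgraph) (phi : G -> R * R) (a b c : G) : Prop := Face {
  face_ab : adj a b;
  face_bc : adj b c;
  face_ca : adj c a;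
  face_ccw : 0 < det (phi a) (phi b) (phi c);
  face_vertex v : ~~ interior (phi a) (phi b) (phi c) (phi v);
  face_edge u w z : adj u w -> on_segment (phi u) (phi w) z ->
    ~~ interior (phi a) (phi b) (phi c) z
}.

Lemma face_cycle (G : sgraph) (phi : G -> R * R) (a b c : G) :
  face phi a b c -> face phi b c a.
Proof.
case=> ab bc ca ccw fv fe; split=> //; first by rewrite det_cycle.
  by move=> v; rewrite interior_cycle.
by move=> u w z uw /(fe _ _ _ uw) h; rewrite interior_cycle.
Qed.

(* All that [psi] adds to [phi] lies in [T], up to vertices of [phi]. *)
Record extends (G : sgraph) (phi : G -> R * R) (H : sgraph) (psi : H -> R * R)
  (i : G -> H) (T : pred (R * R)) : Prop := Extends {
  extends_inj : injective i;
  extends_adj u v : adj u v -> adj (i u) (i v);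
  extends_pos v : psi (i v) = phi v;
  extends_vertex x : (exists v, x = i v) \/ T (psi x);
  extends_edge x y : adj x y ->
    (exists u v, [/\ x = i u, y = i v & adj u v]) \/
    forall z, on_segment (psi x) (psi y) z -> (exists v, z = phi v) \/ T z
}.

Lemma extends_comp (G : sgraph) (phi : G -> R * R) (H : sgraph)
  (psi : H -> R * R) (K : sgraph) (chi : K -> R * R) i j (T T' : pred (R * R)) :
  (forall z, T' z -> T z) ->
  extends phi psi i T -> extends psi chi j T' -> extends phi chi (j \o i) T.
Proof.
move=> TT' [iinj iadj ipos ivert iedge] [jinj jadj jpos jvert jedge].
split.
- exact: inj_comp.
- by move=> u v uv; apply/jadj/iadj.
- by move=> v /=; rewrite jpos.
- move=> x; have [[y ->]|/TT'] := jvert x; last by right.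
  by rewrite jpos; have [[v ->]|] := ivert y; [left; exists v | right].
- move=> x y xy; have [[x' [y' [-> -> x'y']]]|h] := jedge x y xy.
    have [[u [v [-> -> uv]]]|h] := iedge _ _ x'y'; first by left; exists u, v.
    by right=> z; rewrite !jpos; apply: h.
  right=> z /h[[v ->]|/TT']; last by right.
  by have [[v' ->]|] := ivert v; [rewrite ipos; left; exists v' | right].
Qed.

(** All additions are old vertex points or lie in [T], so filling one face keeps the faces disjoint
    from it empty. *)
Lemma extends_face (G : sgraph) (phi : G -> R * R) (H : sgraph)
  (psi : H -> R * R) i (T : pred (R * R)) a b c :
  extends phi psi i T -> face phi a b c ->
  (forall z, T z -> ~~ interior (phi a) (phi b) (phi c) z) ->
  face psi (i a) (i b) (i c).
Proof.
move=> [iinj iadj ipos ivert iedge] [ab bc ca ccw fv fe] disj.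
split; rewrite ?ipos //; try exact: iadj.
- by move=> x; have [[v ->]|/disj//] := ivert x; rewrite ipos.
- move=> x y z xy; have [[u [v [-> -> uv]]]|h] := iedge x y xy.
    by rewrite !ipos; apply: fe.
  by move=> /h[[v ->]|/disj].
Qed.

Definition stack_pos (G : sgraph) (phi : G -> R * R) (S : {set G}) (d : R * R) :
  add_vertex S -> R * R := fun x => if x is Some v then phi v else d.

(** * Stacking a vertex at the centroid of a face *)

Section Stack.
Variables (G : sgraph) (phi : G -> R * R) (S : {set G}) (d : R * R).
Let H : sgraph := add_vertex S.
Let psi : H -> R * R := stack_pos phi d.

Record corners (a b c : G) : Prop := Corners {
  corners_set v : v \in S -> [\/ v = a, v = b | v = c];
  corners_mem : [/\ a \in S, b \in S & c \in S];
  corners_centroid : d = centroid (phi a) (phi b) (phi c)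
}.

Lemma corners_cycle a b c : corners a b c -> corners b c a.
Proof.
case=> h [aS bS cS] dE; split=> //; last by rewrite centroid_cycle.
by move=> v /h[]->; [constructor 3|constructor 1|constructor 2].
Qed.

Variables a b c : G.
Hypotheses (St : straight phi) (F : face phi a b c) (C : corners a b c).
Local Notation T := (interior (phi a) (phi b) (phi c)).

Let spoke v z : v \in S -> on_segment (phi v) d z -> z = phi v \/ T z.
Proof.
have bca := face_ccw (face_cycle F).
have cab := face_ccw (face_cycle (face_cycle F)).
case: C => h _ dE /h[]->; rewrite dE.
- exact: (spoke_interior (face_ccw F)).
- by rewrite -centroid_cycle -interior_cycle; apply: spoke_interior.
- rewrite -2!interior_cycle -(centroid_cycle (phi a)) -centroid_cycle.
  exact: spoke_interior.
Qed.

Let d_interior : T d.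
Proof.
have h1 := det_centroid_gt0 (face_ccw F).
have h2 := det_centroid_gt0 (face_ccw (face_cycle F)).
have h3 := det_centroid_gt0 (face_ccw (face_cycle (face_cycle F))).
case: C => _ _ ->; rewrite /interior h1.
by rewrite -(centroid_cycle (phi a)) h2 -centroid_cycle h3.
Qed.

(** A spoke runs inside the empty face except at its corner, so it can meet an old edge only there.
    Two different spokes are not collinear by [det_centroid_neq0] and meet only at [d]. *)
Lemma stack_straight : straight psi.
Proof.
have psiN : psi None = d by [].
have vertS (u : G) (v : H) : u \in S -> on_segment (phi u) d (psi v) ->
    v = Some u \/ v = None.
  case: v => [v|]; last by right.
  move=> uS /(spoke uS)[/(straight_inj St) ->|]; first by left.
  by rewrite (negPf (face_vertex F v)).
have spoke_old v x y z : v \in S -> adj x y -> on_segment (phi v) d z ->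
    on_segment (phi x) (phi y) z -> (v = x \/ v = y) /\ z = phi v.
  move=> vS xy h hxy; have [e|] := spoke vS h.
    by split=> //; apply: (straight_vertex St xy); rewrite -e.
  by rewrite (negPf (face_edge F xy hxy)).
have spokes v v' z : v \in S -> v' \in S -> v != v' -> on_segment (phi v) d z ->
    on_segment (phi v') d z -> z = d.
  move=> vS v'S vv' /on_segmentC h /on_segmentC h'; apply: segments_meet h h'.
  have := det_centroid_neq0 (face_ccw F); rewrite /= -(corners_centroid C).
  case=> n1 n2 n3 n4 [n5 n6].
  have := corners_set C vS; have := corners_set C v'S.
  by case=> e []e' ; rewrite e e' // in vv' *; rewrite eqxx in vv'.
split.
- move=> [u|] [v|] //=; first by move/(straight_inj St) ->.
    by move=> e; have := face_vertex F u; rewrite e d_interior.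
  by move=> e; have := face_vertex F v; rewrite -e d_interior.
- move=> [u|] [w|] v //= uw.
  + case: v => [v|] /= h.
      by have [->|->] := straight_vertex St uw h; auto.
    by have := face_edge F uw h; rewrite d_interior.
  + exact: vertS.
  + by move/on_segmentC/(vertS _ _ uw) => []; auto.
have core_old u w u' w' z : adj u w -> adj u' w' ->
    on_segment (phi u) (phi w) z -> on_segment (phi u') (phi w') z ->
    meet_at psi (Some u) (Some w) (Some u') (Some w') z.
  move=> uw u'w' h h'.
  case: (straight_cross St uw u'w' h h') => [[-> ->]|[-> ->]|[v [e e' ->]]].
  - by constructor 1.
  - by constructor 2.
  - by constructor 3; exists (Some v); split=> //; [case: e|case: e'] => ->; auto.
have core_mix v x y z : v \in S -> adj x y -> on_segment (phi v) d z ->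
    on_segment (phi x) (phi y) z ->
    meet_at psi (Some v) None (Some x) (Some y) z.
  move=> vS xy h hxy; have [e ze] := spoke_old v x y z vS xy h hxy.
  by constructor 3; exists (Some v); split=> //; [left|case: e => ->; auto].
have core_new v v' z : v \in S -> v' \in S -> on_segment (phi v) d z ->
    on_segment (phi v') d z -> meet_at psi (Some v) None (Some v') None z.
  move=> vS v'S h h'; have [->|ne] := eqVneq v v'; first by constructor 1.
  by constructor 3; exists None; split; [right|right|exact: (spokes v v')].
move=> [u|] [w|] [u'|] [w'|] z //= uw u'w' h h'.
- exact: core_old.
- exact/meet_at_sym/core_mix.
- by move/on_segmentC: h' => h'; apply/meet_at_sym/meet_at_swap/core_mix.
- exact: core_mix.
- exact: core_new.
- move/on_segmentC: h' => h'.
  by apply/meet_at_sym/meet_at_swap/meet_at_sym/core_new.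
- by move/on_segmentC: h => h; apply/meet_at_swap/core_mix.
- by move/on_segmentC: h => h; apply/meet_at_swap/core_new.
- move/on_segmentC: h => h; move/on_segmentC: h' => h'.
  by apply/meet_at_swap/meet_at_sym/meet_at_swap/meet_at_sym/core_new.
Qed.

Lemma stack_extends : extends phi psi (Some : G -> H) T.
Proof.
split=> //.
- by move=> [v|]; [left; exists v | right; apply: d_interior].
- move=> [x|] [y|] //= xy.
  + by left; exists x, y.
  + by right=> z /(spoke xy)[->|]; [left; exists x|right].
  + by right=> z /on_segmentC/(spoke xy)[->|]; [left; exists y|right].
Qed.

Lemma stack_face : face psi (Some a : H) (Some b : H) (None : H).
Proof.
have [aS bS cS] := corners_mem C.
have abd : 0 < det (phi a) (phi b) d.
  by rewrite (corners_centroid C); apply: (det_centroid_gt0 (face_ccw F)).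
have inT z : interior (phi a) (phi b) d z -> T z.
  by rewrite (corners_centroid C); apply: interior_centroid.
have out v z : v \in S -> on_segment (phi v) d z ->
    ~~ interior (phi a) (phi b) d z.
  move=> vS h; apply/negP => /and3P[_ bd da].
  case: (corners_set C vS) => e; rewrite {}e in h.
  - by move/on_segmentC/on_segment_det: h => h; rewrite h ltxx in da.
  - by move/on_segment_det: h => h; rewrite h ltxx in bd.
  (* The spoke from [c] stays on the far side of the line through [b] and [d]. *)
  case: h bd => t /andP[t0 t1] ->; rewrite det_segment det_pqq mulr0 addr0.
  apply/negP; rewrite -leNgt mulr_ge0_le0 ?subr_ge0 //.
  have := det_centroid_gt0 (face_ccw (face_cycle F)).
  rewrite centroid_cycle -(corners_centroid C) => bcd.
  by rewrite det_cycle det_swap oppr_le0 ltW.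
split=> //; first exact: face_ab F.
- by move=> [v|] /=; [apply: contra (face_vertex F v); apply: inT |
    rewrite /interior det_pqq ltxx andbF].
- move=> [x|] [y|] z //= xy.
  + by move/(face_edge F xy); apply: contra; apply: inT.
  + exact: out.
  + by move/on_segmentC; apply: out.
Qed.

End Stack.
End Straight.

(** * Construction of a planar 3-tree with deeply filled faces *)

Definition stackable (G : sgraph) : Prop :=
  forall S : {set G}, #|S| = 3%N -> clique S -> three_tree (add_vertex S).

Lemma three_tree_stackable (G : sgraph) : three_tree G -> stackable G.
Proof. by move=> tG S; apply: three_tree_add. Qed.

(** This lets the construction start from a triangle, which is not a 3-tree: its only set of three
    vertices is the whole vertex set, and stacking there gives the complete graph on four
    vertices. *)
Lemma complete3_stackable : stackable (complete 3).
Proof.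
move=> S S3 _; apply: (three_tree_iso three_tree_K4).
have ST : S = [set: 'I_3]%SET.
  by apply/eqP; rewrite eqEcard finset.subsetT /= cardsT card_ord S3.
exists (unlift ord0 : complete 4 -> add_vertex S).
  exists (fun x : option 'I_3 => if x is Some j then lift ord0 j else ord0).
    by move=> i; case: unliftP => [j ->|->].
  by case=> [j|]; rewrite ?liftK ?unlift_none.
move=> x y; rewrite /= /complete_adj; case: unliftP => [i ->|->];
  case: unliftP => [j ->|->] //=; rewrite ?ST ?inE ?eqxx //.
Qed.

Lemma filled_map (G H : sgraph) (i : G -> H) k (a b c x : G) :
  injective i -> (forall u v, adj u v -> adj (i u) (i v)) ->
  filled k a b c x -> filled k (i a) (i b) (i c) (i x).
Proof.
move=> inj iadj; elim: k a b c x => //= k IH a b c x [d [dx K h1 h2 h3]].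
exists (i d); split; try exact: IH; first by rewrite (inj_eq inj).
by case/and4P: K => ? ? ? /and3P[? ? ?]; rewrite /K4 !iadj.
Qed.

(** Stack at the centroid, then fill the three small faces in turn; their interiors are disjoint, so
    each remains a face until its turn. At [k = 0] nothing is stacked, whence the proviso on
    [three_tree H]. *)
Lemma fill_face (R : realType) k (G : sgraph) (phi : G -> R * R) (a b c x : G) :
  straight phi -> stackable G -> face phi a b c ->
  exists (H : sgraph) (psi : H -> R * R) (i : G -> H),
    [/\ straight psi, extends phi psi i (interior (phi a) (phi b) (phi c)),
        filled k (i a) (i b) (i c) (i x)
      & three_tree G \/ (0 < k)%N -> three_tree H].
Proof.
elim: k G phi a b c x => [|k IH] G phi a b c x St Gs F.
  exists G, phi, id; split=> //; last by case.
  split=> //; first by move=> y; left; exists y.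
  by move=> y z; left; exists y, z.
have ab := face_ab F; have bc := face_bc F; have ca := face_ca F.
pose S := [set a; b; c]%SET.
pose d := centroid (phi a) (phi b) (phi c).
have C : corners phi S d a b c.
  split=> //; last by rewrite !inE !eqxx !orbT.
  by move=> v; rewrite !inE => /orP[/orP[]|] /eqP; [constructor 1|constructor 2|constructor 3].
have S3 : #|S| = 3%N.
  by rewrite /S finset.setUC cardsU1 cards2 !inE negb_or (adj_neq ca) (eq_sym c)
    (adj_neq bc) (adj_neq ab).
have Sc : clique S.
  have [ba cb ac] : [/\ adj b a, adj c b & adj a c].
    by rewrite !(adj_sym b a) !(adj_sym c b) !(adj_sym a c).
  by move=> u v /(corners_set C)[]-> /(corners_set C)[]->; rewrite ?eqxx.
pose H1 := add_vertex S; pose phi1 : H1 -> R * R := stack_pos phi d.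
have t1 : three_tree H1 by apply: Gs.
have St1 : straight phi1 := stack_straight St F C.
have E1 := stack_extends F C.
have F1 := stack_face F C.
have F2 := stack_face (face_cycle F) (corners_cycle C).
have F3 := stack_face (face_cycle (face_cycle F)) (corners_cycle (corners_cycle C)).
rewrite -/phi1 in E1 F1 F2 F3.
have d2 : d = centroid (phi b) (phi c) (phi a) by rewrite centroid_cycle.
have d3 : d = centroid (phi c) (phi a) (phi b) by rewrite centroid_cycle.
pose I1 := interior (phi a) (phi b) d.
pose I2 := interior (phi b) (phi c) d.
pose I3 := interior (phi c) (phi a) d.
have I12 z : I1 z -> ~~ I2 z by apply: interior_disjoint.
have I13 z : I1 z -> ~~ I3 z.
  by apply: contraL; rewrite /I1 /I3 d3; apply: interior_disjoint.
have I23 z : I2 z -> ~~ I3 z by rewrite /I2 /I3 d2; apply: interior_disjoint.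
have sub1 z : I1 z -> interior (phi a) (phi b) (phi c) z.
  exact: interior_centroid.
have sub2 z : I2 z -> interior (phi a) (phi b) (phi c) z.
  by rewrite -interior_cycle /I2 d2; apply: interior_centroid.
have sub3 z : I3 z -> interior (phi a) (phi b) (phi c) z.
  by rewrite -2!interior_cycle /I3 d3; apply: interior_centroid.
have [H2 [phi2 [i2 [St2 E2 fill1 t2]]]] :=
  IH H1 phi1 _ _ _ (Some c) St1 (three_tree_stackable t1) F1.
have F2' := extends_face E2 F2 I12; have F3' := extends_face E2 F3 I13.
have [H3 [phi3 [i3 [St3 E3 fill2 t3]]]] :=
  IH H2 phi2 _ _ _ (i2 (Some a)) St2
    (three_tree_stackable (t2 (or_introl t1))) F2'.
rewrite !(extends_pos E2) in E3.
have disj z : I2 z -> ~~ interior (phi2 (i2 (Some c))) (phi2 (i2 (Some a)))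
    (phi2 (i2 None)) z by rewrite !(extends_pos E2); apply: I23.
have F3'' := extends_face E3 F3' disj.
have [H4 [phi4 [i4 [St4 E4 fill3 t4]]]] :=
  IH H3 phi3 _ _ _ (i3 (i2 (Some b))) St3
    (three_tree_stackable (t3 (or_introl (t2 (or_introl t1))))) F3''.
rewrite !(extends_pos E3) !(extends_pos E2) in E4.
have E12 := extends_comp sub1 E1 E2.
have E13 := extends_comp sub2 E12 E3.
have E14 := extends_comp sub3 E13 E4.
exists H4, phi4, (i4 \o (i3 \o (i2 \o Some))); split=> //; last first.
  by move=> _; apply/t4/or_introl/t3/or_introl/t2/or_introl/t1.
have inj3 := extends_inj E3; have adj3 := extends_adj E3.
have inj4 := extends_inj E4; have adj4 := extends_adj E4.
exists (i4 (i3 (i2 None))); split.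
- by rewrite /= (inj_eq inj4) (inj_eq inj3) (inj_eq (extends_inj E2)).
- have K : K4 (Some a : H1) (Some b) (Some c) None.
    have [aS bS cS] := corners_mem C.
    by rewrite /K4 /= ab bc adj_sym ca aS bS cS.
  have adj2 := extends_adj E2.
  case/and4P: K => ? ? ? /and3P[? ? ?]; apply/and4P; split;
    [by apply/adj4/adj3/adj2..|apply/and3P; split; by apply/adj4/adj3/adj2].
(* Fillings made earlier are carried through the later extensions. *)
- exact: filled_map inj4 adj4 (filled_map inj3 adj3 fill1).
- exact: filled_map inj4 adj4 fill2.
- exact: filled_swap12 fill3.
Qed.

Lemma noncollinear_straight (R : realType) (phi : 'I_3 -> R * R) :
  (forall i j k, i != j -> i != k -> j != k ->
     det (phi i) (phi j) (phi k) != 0) ->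
  @straight R (complete 3) phi.
Proof.
move=> nc; have inj : injective phi.
  move=> i j e; apply/eqP; apply: contraT => ij.
  have [k ik jk] : exists2 k : 'I_3, i != k & j != k.
    by case: i ij {e} => -[|[|[|]]] // ?; case: j => -[|[|[|]]] // ? _;
      [exists (inord 2)|exists (inord 1)|exists (inord 2)|exists (inord 0)|
       exists (inord 1)|exists (inord 0)]; rewrite -val_eqE /= inordK.
  by have := nc i j k ij ik jk; rewrite e det_pp eqxx.
split=> //.
- move=> u w v; rewrite /= /complete_adj => uw /on_segment_det dz.
  have [->|vu] := eqVneq v u; first by left.
  have [->|vw] := eqVneq v w; first by right.
  by have := nc u w v uw; rewrite eq_sym vu eq_sym vw dz eqxx => /(_ isT isT).
have core (u w w' : complete 3) z : adj u w -> adj u w' ->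
    on_segment (phi u) (phi w) z -> on_segment (phi u) (phi w') z ->
    meet_at (G := complete 3) phi u w u w' z.
  move=> uw uw' h h'; have [->|ne] := eqVneq w w'; first by constructor 1.
  constructor 3; exists u; split; [by left|by left|].
  by apply: segments_meet h h'; apply: nc.
move=> u w u' w' z uw u'w' h h'.
have wu : adj w u by rewrite adj_sym.
have w'u' : adj w' u' by rewrite adj_sym.
have [e|uu'] := eqVneq u u'; first by rewrite -e in u'w' h' *; apply: core.
have [e|uw'] := eqVneq u w'.
  move/on_segmentC: h' => h'; rewrite -e in w'u' h' *.
  by apply/meet_at_sym/meet_at_swap/meet_at_sym/core.
have [e|wu'] := eqVneq w u'.
  by move/on_segmentC: h => h; rewrite -e in u'w' h' *; apply/meet_at_swap/core.
have [e|ww'] := eqVneq w w'.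
  move/on_segmentC: h' => h'; move/on_segmentC: h => h; rewrite -e in w'u' h' *.
  by apply/meet_at_swap/meet_at_sym/meet_at_swap/meet_at_sym/core.
(* Two edges without a common end would need four vertices. *)
exfalso; move: uw u'w' uu' uw' wu' ww' (ltn_ord u) (ltn_ord w) (ltn_ord u') (ltn_ord w').
by rewrite /= /complete_adj -!val_eqE /=; clear; lia.
Qed.

Theorem theorem15 (R : realType) :
  exists G : sgraph,
    [/\ three_tree G, planar R G & ~ has_plane_delta2_obstacle_embedding R G].
Proof.
(* The counterclockwise triangle with corners (0,0), (1,0) and (0,1). *)
pose phi (i : complete 3) : R * R := ((i == 1 :> nat)%:R, (i == 2 :> nat)%:R).
have St : straight phi.
  apply: noncollinear_straight => i j k; rewrite /phi /det -!val_eqE /=.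
  by case: i => -[|[|[|]]] //= ?; case: j => -[|[|[|]]] //= ?;
    case: k => -[|[|[|]]] //= ? _ _ _; apply/eqP; lra.
pose a : complete 3 := @Ordinal 3 0 isT; pose b : complete 3 := @Ordinal 3 1 isT.
pose c : complete 3 := @Ordinal 3 2 isT.
have F : face phi a b c.
  split=> //; first by rewrite /det /phi /=; lra.
    move=> v; apply/negP => /and3P[]; rewrite /det /phi /=.
    by case: v => -[|[|[|]]] //= ?; lra.
  move=> u w z uw /on_segment_det uwz; apply/negP => /and3P[].
  move: uw uwz; rewrite /= /complete_adj -val_eqE /det /phi /=.
  by case: u => -[|[|[|]]] //= ?; case: w => -[|[|[|]]] //= ?; lra.
(* Of the five levels, one gives a [K4], one reaches a bounded face of it, one reaches a corner
   triangle and two exclude that triangle. The initial triangle has no vertex on its other side, so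
   [a] takes that place; a vertex stacked into the triangle differs from it. *)
have [H [psi [i [Sp _ fill tH]]]] := fill_face 5 a St complete3_stackable F.
exists H; split; first by apply: tH; right.
  exact: straight_planar Sp.
move=> [chi [curve emb]].
exact: (diagram_not_filled (embedding_diagram emb) fill).
Qed.
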